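(* Let $G=(V,E)$ be an infinite graph without multiple edges and self-loops, and let $D$ be an integer such that $3\le D(x)\le D$ for all $x\in V$, where $D(x)$ is the degree of $x$. (i) Let $c$ be a real number. If the spectrum of $\mathcal{S}^{*2}\mathcal{S}^2$ on $\ell^2(B,U)$ is contained in $[0,1-c]$, then the spectrum of $P^2$ on $\ell^2(V,\pi)$ is contained in $[0,1-D^{-2}c]$. (ii) Let $\beta>0$. If the spectrum of $P^2$ on $\ell^2(V,\pi)$ is contained in $[0,1-\beta]$, then the spectrum of $\mathcal{S}^{*2}\mathcal{S}^2$ on $\ell^2(B,U)$ is contained in $[0,1-c(D,\beta)]$, where, with $Q=D-1$, $$c(D,\beta)=\min\left(\frac{Q^{-4}\beta}{2(1+Q^{-4}\beta/6)^{2}},\;\frac{Q^{-4}\beta}{(1+6Q^4/\beta)^{2}}\right).$$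
   Context: For vertices, $y\sim x$ means that $y$ is a neighbour of $x$. The measure $\pi$ on $V$ is $\pi(x)=D(x)$, and the operator $P$ is $Pf(x)=\frac{1}{D(x)}\sum_{y\sim x}f(y)$; it is self-adjoint on $\ell^2(V,\pi)$. $B$ is the set of oriented edges of $G$ (each edge of $E$ gives two oriented edges), endowed with the uniform measure $U$ giving weight $1$ to each oriented edge. For $e\in B$, $o(e)$ is its origin and $t(e)$ its terminus. For $e,e'\in B$, $e'\leadsto e$ means that $t(e')=o(e)$ and $e$ is not the reverse of $e'$. The (bounded) operator $\mathcal{S}$ on $\ell^2(B,U)$ is $\mathcal{S}f(e)=\frac{1}{D(o(e))-1}\sum_{e'\leadsto e}f(e')$, and $\mathcal{S}^*$ is its adjoint on $\ell^2(B,U)$. *)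

(* Defs.v *)
From mathcomp Require Import all_boot all_order all_algebra finmap complex.
From mathcomp Require Import all_classical all_reals all_analysis.
From mathcomp Require summability.

Set Implicit Arguments.
Unset Strict Implicit.
Unset Printing Implicit Defensive.

Import Order.TTheory GRing.Theory Num.Theory.
Import numFieldNormedType.Exports.

Local Open Scope classical_set_scope.
Local Open Scope ring_scope.

Section L2.
Context {R : realType} {X : choiceType}.
Local Notation C := R[i].
Implicit Types (w : X -> R) (f g : X -> C) (T : (X -> C) -> (X -> C)).

Definition l2_sqnorm w f : \bar R :=
  (\esum_(x in [set: X]) (w x * (Normc.normc (f x)) ^+ 2)%:E)%E.

Definition l2 w : set (X -> C) := [set f | (l2_sqnorm w f < +oo)%E].

(* The sum is the unconditional one: the limit of the finite partial sums along
   the directed family of finite subsets of X. *)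
Definition l2_inner w f g : C :=
  @summability.sum X _ (C^o) (fun x => (w x)%:C%C * f x * ((g x)^*)%C).

(* Operators are total maps on X -> C, but only their action on l2 w matters;
   the bound implies that T maps l2 w into itself. *)
Definition bounded_operator w T : Prop :=
  (forall (a : C) f g, l2 w f -> l2 w g ->
     T (fun x => a * f x + g x) = (fun x => a * T f x + T g x)) /\
  (exists M : R, forall f, l2 w f ->
     (l2_sqnorm w (T f) <= M%:E * l2_sqnorm w f)%E).

Definition is_adjoint w T (T' : (X -> C) -> (X -> C)) : Prop :=
  bounded_operator w T' /\
  (forall f g, l2 w f -> l2 w g -> l2_inner w (T f) g = l2_inner w f (T' g)).

(* Unspecified outside l2 w, and everywhere if T has no adjoint. *)
Definition adjoint w T : (X -> C) -> (X -> C) :=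
  if pselect (exists T', is_adjoint w T T') is left ex then projT1 (cid ex)
  else idfun.

Definition resolvent_set w T : set C :=
  [set z | exists2 Rz : (X -> C) -> (X -> C), bounded_operator w Rz &
    forall f, l2 w f ->
      Rz (fun x => T f x - z * f x) = f /\
      (fun x => T (Rz f) x - z * Rz f x) = f].

Definition spectrum w T : set C := ~` resolvent_set w T.

End L2.

(* The real interval [a, b], as a subset of the complex plane. *)
Definition real_segment {R : realType} (a b : R) : set R[i] :=
  [set (t%:C)%C | t in `[a, b]].

Section Graph.
Context {V : choiceType} (adj : rel V).

Definition neighbors (x : V) : set V := [set y | adj x y].

Definition locally_finite : Prop := forall x, finite_set (neighbors x).

(* Meaningful only when neighbors x is finite: fset_set is empty otherwise. *)
Definition degree (x : V) : nat := #|` fset_set (neighbors x)|.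

Definition oriented_edge : Type := {p : V * V | adj p.1 p.2}.

Definition origin (e : oriented_edge) : V := (val e).1.
Definition terminus (e : oriented_edge) : V := (val e).2.

Definition is_reverse (e e' : oriented_edge) : Prop :=
  origin e = terminus e' /\ terminus e = origin e'.

Definition leads_to (e' e : oriented_edge) : Prop :=
  terminus e' = origin e /\ ~ is_reverse e e'.

Context {R : realType}.
Local Notation C := R[i].

Definition vertex_measure (x : V) : R := (degree x)%:R.

Definition edge_measure (_ : oriented_edge) : R := 1.

Definition srw_op (f : V -> C) : V -> C :=
  fun x => (degree x)%:R^-1 * \sum_(y \in neighbors x) f y.

Definition nbrw_op (f : oriented_edge -> C) : oriented_edge -> C :=
  fun e => ((degree (origin e))%:R - 1)^-1 *
           \sum_(e' \in [set e' | leads_to e' e]) f e'.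

Definition srw_sq : (V -> C) -> (V -> C) := srw_op \o srw_op.

Definition nbrw_adj : (oriented_edge -> C) -> (oriented_edge -> C) :=
  adjoint edge_measure nbrw_op.

Definition nbrw_adj2_nbrw2 : (oriented_edge -> C) -> (oriented_edge -> C) :=
  nbrw_adj \o nbrw_adj \o nbrw_op \o nbrw_op.

End Graph.

Definition gap_constant {R : realType} (D : nat) (beta : R) : R :=
  let Q : R := D%:R - 1 in
  Num.min
    (Q ^- 4 * beta / (2 * (1 + Q ^- 4 * beta / 6) ^+ 2))
    (Q ^- 4 * beta / (1 + 6 * Q ^+ 4 / beta) ^+ 2).

(* Main.v *)
(* Writing q = 1/(D(o(e)) - 1), let J be the reversal of edges, A the averaging
   over the edges with a given origin and K = A - q (1 - A).  Then S = K J and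
   S* = J K.  On functions lifted from V along the origin map, A J acts as P.
   Hence for g = J F, with F lifted from phi, one has A S^2 g = P phi, which
   gives |P phi|^2 <= |S^2 g|^2.  Conversely, as q <= 1/2, each application of K
   to g loses at least (3/4) |(1 - A) g|^2: either (1 - A) g is already
   substantial, or g is nearly lifted and (1 - A) J A g, of squared norm
   |A g|^2 - |P A g|^2 >= beta |A g|^2, makes the second step lose; quantitatively
   |S^2|^2 <= 1 - 3 beta / 8.
   The spectra enter through the following fact on T = W* W: the spectrum is in
   [0, b] iff |W f|^2 <= b |f|^2 for all f.  Off [0, b] the operator T - z is
   bounded below together with its adjoint, hence inverted by a Neumann series;
   and the best constant b is itself in the spectrum. *)
Require Import Defs.
From mathcomp Require Import all_boot all_order all_algebra finmap complex.
From mathcomp Require Import all_classical all_reals all_analysis.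
From mathcomp Require summability.
From mathcomp Require Import ring lra.

Set Implicit Arguments.
Unset Strict Implicit.
Unset Printing Implicit Defensive.

Import Order.TTheory GRing.Theory Num.Theory.
Import numFieldNormedType.Exports.

Local Open Scope classical_set_scope.
Local Open Scope ring_scope.

#[local] Existing Instance summability.totally_filter.

(** * Square-summable functions *)

Section PartialSums.
Context {R : realType} {X : choiceType}.
Local Notation psum := (@summability.partial_sum X _).
Implicit Types (a b : X -> R) (A B : {fset X}).

Lemma psumE (K : zmodType) (a : X -> K) A : psum a A = \sum_(x <- A) a x.
Proof. by rewrite /summability.partial_sum big_seq_fsetE. Qed.

Lemma psumD (K : zmodType) (a b : X -> K) A :
  psum (fun x => a x + b x) A = psum a A + psum b A.
Proof. by rewrite !psumE big_split. Qed.

Lemma psumZ (K : pzRingType) (r : K) (a : X -> K) A :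
  psum (fun x => r * a x) A = r * psum a A.
Proof. by rewrite !psumE mulr_sumr. Qed.

Lemma psum_ge0 a A : (forall x, 0 <= a x) -> 0 <= psum a A.
Proof. by move=> a0; rewrite psumE sumr_ge0. Qed.

Lemma ler_psum a b A : (forall x, a x <= b x) -> psum a A <= psum b A.
Proof. by move=> ab; rewrite !psumE ler_sum. Qed.

Lemma psum_subset a A B : (forall x, 0 <= a x) -> (A `<=` B)%fset ->
  psum a A <= psum a B.
Proof.
move=> a0 AB; rewrite !psumE [leRHS](big_fsetID _ (mem A)) /=.
rewrite (_ : [fset x in B | x \in A]%fset = A) ?lerDl ?sumr_ge0//.
by apply/fsetP => x; rewrite !inE andbC; case: (boolP (x \in A)) => // /(fsubsetP AB) ->.
Qed.

Lemma psum_fset1 (K : zmodType) (a : X -> K) x : psum a [fset x]%fset = a x.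
Proof. by rewrite psumE big_seq_fset1. Qed.

Lemma psum_le_esum a A : (forall x, 0 <= a x) ->
  ((psum a A)%:E <= \esum_(x in [set: X]) (a x)%:E)%E.
Proof.
move=> a0; apply: esum_ge; exists [set` A]; first by split.
by rewrite -fsbig_seq// psumE sumEFin.
Qed.

Lemma esum_le_psum a (M : \bar R) :
  (forall A, ((psum a A)%:E <= M)%E) -> (\esum_(x in [set: X]) (a x)%:E <= M)%E.
Proof.
move=> aM; apply: ge_ereal_sup => _ [F [finF _] <-].
rewrite fsbig_finite//= (le_trans _ (aM (fset_set F)))// psumE.
by rewrite -sumEFin.
Qed.

(** The partial sums increase along the directed family of finite sets, so they converge to their
    supremum. This links the extended sum defining [l2_sqnorm] to the limits that define inner
    products. *)
Lemma psum_cvg_esum a : (forall x, 0 <= a x) ->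
    (\esum_(x in [set: X]) (a x)%:E < +oo)%E ->
  psum a @ summability.totally --> fine (\esum_(x in [set: X]) (a x)%:E).
Proof.
move=> a0 fin; set s := esum _ _ in fin *.
have sfin : s \is a fin_num.
  by rewrite ge0_fin_numE//; apply: esum_ge0 => x _; rewrite lee_fin.
have le_s A : psum a A <= fine s by rewrite -lee_fin fineK// psum_le_esum.
apply/cvgrPdist_lt => e e0.
have [A sA] : exists A, fine s - e < psum a A.
  apply: contrapT => /forallNP H.
  have : (s <= (fine s - e)%:E)%E.
    by apply: esum_le_psum => A; rewrite lee_fin leNgt; apply/negP/H.
  by rewrite -{1}(fineK sfin) lee_fin lerBrDr gerDl leNgt e0.
exists A => // B /= AB.
rewrite ger0_norm ?subr_ge0//.
by rewrite ltrBlDr -ltrBlDl (lt_le_trans sA)// psum_subset.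
Qed.

End PartialSums.

(** * The complex plane as a Euclidean plane *)

Section ComplexPlane.
Context {R : realType}.
Local Notation C := R[i].

(** The real part of [a] times the conjugate of [b]. Keeping to this real form leaves the estimates
    in [R], within reach of [lra] and [nra]. *)
Definition dot (a b : C) : R :=
  complex.Re a * complex.Re b + complex.Im a * complex.Im b.

Lemma sqr_normc_dot (a : C) : Normc.normc a ^+ 2 = dot a a.
Proof. by case: a => a b; rewrite /= sqr_sqrtr ?addr_ge0 ?sqr_ge0// !expr2. Qed.

Lemma dot_ge0 (a : C) : 0 <= dot a a.
Proof. by rewrite -sqr_normc_dot sqr_ge0. Qed.

Lemma dot_eq0 (a : C) : dot a a = 0 -> a = 0.
Proof.
case: a => a b /eqP; rewrite /dot /= paddr_eq0 ?sqr_ge0 -?expr2// !sqrf_eq0.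
by case/andP => /eqP -> /eqP ->.
Qed.

Lemma dotC (a b : C) : dot a b = dot b a.
Proof. by rewrite /dot; ring. Qed.

Lemma dotDl (a b c : C) : dot (a + b) c = dot a c + dot b c.
Proof. by case: a b c => ? ? [? ?] [? ?]; rewrite /dot /=; ring. Qed.

Lemma dotMl (a b c : C) : dot (a * b) c = dot b ((a^*)%C * c).
Proof. by case: a b c => ? ? [? ?] [? ?]; rewrite /dot /=; ring. Qed.

Lemma dot_real (r : R) (a b : C) : dot (r%:C%C * a) b = r * dot a b.
Proof. by case: a b => ? ? [? ?]; rewrite /dot /=; ring. Qed.

Lemma dotM (a b : C) : dot (a * b) (a * b) = dot a a * dot b b.
Proof. by case: a b => ? ? [? ?]; rewrite /dot /=; ring. Qed.

Lemma cvg_complex (T : Type) (F : set_system T) {FF : Filter F}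
    (u v : T -> R) (a b : R) :
  u @ F --> a -> v @ F --> b ->
  (fun t => (u t +i* v t)%C : C^o) @ F --> ((a +i* b)%C : C^o).
Proof.
move=> /cvgrPdist_lt ua /cvgrPdist_lt vb; apply/cvgrPdist_lt => -[e e'].
(* The radius is itself a complex number; being positive, it has zero imaginary part. *)
rewrite ltcE /= => /andP[/eqP -> e0].
have e2 : 0 < e / 2 by rewrite divr_gt0.
near=> t.
have ut : `|a - u t| < e / 2 by near: t; exact: ua.
have vt : `|b - v t| < e / 2 by near: t; exact: vb.
rewrite normc_def ltcR /= -[ltRHS]ger0_norm ?ltW// -sqrtr_sqr ltr_sqrt ?exprn_gt0//.
move: ut vt; rewrite !ltr_norml => /andP[u1 u2] /andP[v1 v2].
(* Each product is [(e / 2) ^+ 2] minus the square of one coordinate error, so the squared modulus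
   is below [e ^+ 2 / 2]. *)
have : 0 < (e / 2 - (a - u t)) * (e / 2 + (a - u t)) by apply: mulr_gt0; lra.
have : 0 < (e / 2 - (b - v t)) * (e / 2 + (b - v t)) by apply: mulr_gt0; lra.
by move: e0; nra.
Unshelve. all: by end_near. Qed.

End ComplexPlane.

(** * The real inner product of square-summable functions *)

Section L2Form.
Context {R : realType} {X : choiceType} (w : X -> R).
Context (w_gt0 : forall x, 0 < w x).
Local Notation C := R[i].
Local Notation psum := (@summability.partial_sum X _).
Local Notation l2 := (l2 w).
Implicit Types (f g h : X -> C) (c : C).

Definition scal c f : X -> C := fun x => c * f x.

(** The real part of the weighted inner product. [lim] takes a default value where no limit exists,
    whence the [l2] hypotheses of the additive laws below. *)
Definition rip f g : R :=
  lim (psum (fun x => w x * dot (f x) (g x)) @ summability.totally).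

Definition nsq f : R := rip f f.

Lemma wdot_ge0 f x : 0 <= w x * dot (f x) (f x).
Proof. by rewrite mulr_ge0 ?dot_ge0// ltW. Qed.

Lemma l2_sqnorm_dot f :
  l2_sqnorm w f = (\esum_(x in [set: X]) (w x * dot (f x) (f x))%:E)%E.
Proof. by apply: eq_esum => x _; rewrite sqr_normc_dot. Qed.

Lemma l2_sqnorm_ge0 f : (0 <= l2_sqnorm w f)%E.
Proof. by rewrite l2_sqnorm_dot; apply: esum_ge0 => x _; rewrite lee_fin wdot_ge0. Qed.

Lemma l2_dotP f :
  l2 f <-> (\esum_(x in [set: X]) (w x * dot (f x) (f x))%:E < +oo)%E.
Proof. by rewrite -l2_sqnorm_dot. Qed.

Lemma l2P f : l2 f <-> exists M, forall A, psum (fun x => w x * dot (f x) (f x)) A <= M.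
Proof.
split=> [/l2_dotP fin|[M fM]].
  exists (fine (\esum_(x in [set: X]) (w x * dot (f x) (f x))%:E)%E) => A.
  rewrite -lee_fin fineK; last first.
    by rewrite ge0_fin_numE//; apply: esum_ge0 => x _; rewrite lee_fin wdot_ge0.
  by apply: psum_le_esum => x; exact: wdot_ge0.
apply/l2_dotP.
by apply: (@le_lt_trans _ _ M%:E); rewrite ?ltry//; apply: esum_le_psum => A; rewrite lee_fin.
Qed.

Lemma l2_nsq_cvg f : l2 f ->
  psum (fun x => w x * dot (f x) (f x)) @ summability.totally --> nsq f.
Proof.
move=> /l2_dotP fin.
apply: cvgP; apply: psum_cvg_esum fin => x; exact: wdot_ge0.
Qed.

Lemma l2_sqnormE f : l2 f -> l2_sqnorm w f = (nsq f)%:E.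
Proof.
move=> /l2_dotP fin'.
rewrite l2_sqnorm_dot /nsq /rip.
rewrite (cvg_lim (@Rhausdorff R) (psum_cvg_esum (wdot_ge0 f) fin')) fineK//.
by rewrite ge0_fin_numE//; apply: esum_ge0 => x _; rewrite lee_fin wdot_ge0.
Qed.

Lemma psum_le_nsq f A : l2 f -> psum (fun x => w x * dot (f x) (f x)) A <= nsq f.
Proof.
move=> fin; rewrite -lee_fin -l2_sqnormE// l2_sqnorm_dot.
by apply: psum_le_esum => x; exact: wdot_ge0.
Qed.

Lemma nsq_le f (M : R) : (forall A, psum (fun x => w x * dot (f x) (f x)) A <= M) ->
  l2 f /\ nsq f <= M.
Proof.
move=> fM; have fin : l2 f by apply/l2P; exists M.
split=> //; rewrite -lee_fin -l2_sqnormE// l2_sqnorm_dot.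
by apply: esum_le_psum => A; rewrite lee_fin.
Qed.

Lemma pt_le_nsq f x : l2 f -> w x * dot (f x) (f x) <= nsq f.
Proof.
move=> /(psum_le_nsq [fset x]%fset).
by rewrite (psum_fset1 (fun x => w x * dot (f x) (f x))).
Qed.

Lemma nsq_ge0 f : l2 f -> 0 <= nsq f.
Proof.
by move=> /(psum_le_nsq fset0); apply: le_trans; apply: psum_ge0 => x; exact: wdot_ge0.
Qed.

Lemma nsq_eq0 f : l2 f -> nsq f <= 0 -> f = 0.
Proof.
move=> fin f0; apply: funext => x; apply: dot_eq0; apply/eqP.
rewrite eq_le dot_ge0 andbT -(pmulr_rle0 _ (w_gt0 x)).
exact: le_trans (pt_le_nsq x fin) f0.
Qed.

Lemma l2D f g : l2 f -> l2 g -> l2 (f + g).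
Proof.
move=> lf lg; apply/l2P; exists (2 * nsq f + 2 * nsq g) => A.
apply: (@le_trans _ _ (psum (fun x =>
    2 * (w x * dot (f x) (f x)) + 2 * (w x * dot (g x) (g x))) A)).
  apply: ler_psum => x; have := w_gt0 x; have := dot_ge0 (f x - g x).
  rewrite /= (_ : (f + g) x = f x + g x)//.
  by case: (f x) (g x) => a b [a' b']; rewrite /dot /=; nra.
by rewrite psumD !psumZ lerD// ler_pM2l// psum_le_nsq.
Qed.

Lemma nsq_scal_psum c f A :
  psum (fun x => w x * dot (scal c f x) (scal c f x)) A =
  dot c c * psum (fun x => w x * dot (f x) (f x)) A.
Proof. by rewrite -psumZ; apply: eq_bigr => x _; rewrite dotM mulrCA. Qed.

Lemma l2Z c f : l2 f -> l2 (scal c f).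
Proof.
move=> lf; apply/l2P; exists (dot c c * nsq f) => A.
by rewrite nsq_scal_psum ler_wpM2l ?dot_ge0// psum_le_nsq.
Qed.

Lemma scalN1 f : scal (-1) f = - f.
Proof. by apply: funext => x; rewrite /scal mulN1r. Qed.

Lemma l2N f : l2 f -> l2 (- f).
Proof. by move=> /(l2Z (-1)); rewrite scalN1. Qed.

Lemma l2B f g : l2 f -> l2 g -> l2 (f - g).
Proof. by move=> lf /l2N; exact: l2D. Qed.

Lemma l2_0 : l2 0.
Proof.
apply/l2P; exists 0 => A; rewrite psumE big1// => x _.
by rewrite /dot /= !mul0r addr0 mulr0.
Qed.

(** By polarization, [4 * dot a b] is the squared modulus of [a + b] minus that of [a - b], so
    convergence follows from that of two squared norms. *)
Lemma rip_cvg f g : l2 f -> l2 g ->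
  psum (fun x => w x * dot (f x) (g x)) @ summability.totally --> rip f g.
Proof.
move=> lf lg.
have /l2_nsq_cvg cD : l2 (f + g) by exact: l2D.
have /l2_nsq_cvg cB : l2 (f - g) by exact: l2B.
have c4 := cvgZl_tmp (k := 4^-1) (cvgB cD cB).
suff e : psum (fun x => w x * dot (f x) (g x)) =
    4^-1 \*: (psum (fun x => w x * dot ((f + g) x) ((f + g) x)) -
             psum (fun x => w x * dot ((f - g) x) ((f - g) x))).
  rewrite /rip e. apply: cvgP. exact: c4.
apply: funext => A.
rewrite /= [RHS](_ : _ = 4^-1 * (psum (fun x => w x * dot ((f + g) x) ((f + g) x)) A +
             -1 * psum (fun x => w x * dot ((f - g) x) ((f - g) x)) A)); last by rewrite mulN1r.
rewrite -!psumZ -psumD -psumZ; apply: eq_bigr => x _.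
rewrite (_ : (f + g) _ = f (fsval x) + g (fsval x))// (_ : (f - g) _ = f (fsval x) - g (fsval x))//.
by case: (f _) (g _) => a b [a' b']; rewrite /dot /=; field.
Qed.

Lemma rip_unique f g (u : {fset X} -> R) (r : R) :
  u =1 psum (fun x => w x * dot (f x) (g x)) ->
  u @ summability.totally --> r -> rip f g = r.
Proof. by move=> /funext -> fg; apply/cvg_lim. Qed.

Lemma eq_rip f g f' g' :
  (forall x, dot (f x) (g x) = dot (f' x) (g' x)) -> rip f g = rip f' g'.
Proof.
move=> e; rewrite /rip.
by have -> : (fun x => w x * dot (f x) (g x)) = (fun x => w x * dot (f' x) (g' x))
  by apply: funext => x; rewrite e.
Qed.

Lemma ripC f g : rip f g = rip g f.
Proof. by apply: eq_rip => x; exact: dotC. Qed.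

Lemma rip_scall c f g : rip (scal c f) g = rip f (scal (c^*)%C g).
Proof. by apply: eq_rip => x; exact: dotMl. Qed.

Lemma ripDl f g h : l2 f -> l2 g -> l2 h -> rip (f + g) h = rip f h + rip g h.
Proof.
move=> lf lg lh; apply: rip_unique (cvgD (rip_cvg lf lh) (rip_cvg lg lh)) => A.
rewrite [LHS](_ : _ = psum (fun x => w x * dot (f x) (h x)) A +
                      psum (fun x => w x * dot (g x) (h x)) A)//.
by rewrite -psumD; apply: eq_bigr => x _; rewrite -mulrDr -dotDl.
Qed.

Lemma rip_real (r : R) f g : l2 f -> l2 g -> rip (scal (r%:C)%C f) g = r * rip f g.
Proof.
move=> lf lg; apply: rip_unique (cvgZl_tmp (k := r) (rip_cvg lf lg)) => A.
rewrite [LHS](_ : _ = r * psum (fun x => w x * dot (f x) (g x)) A)//.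
by rewrite -psumZ; apply: eq_bigr => x _; rewrite dot_real mulrCA.
Qed.

Lemma ripN f g : l2 f -> l2 g -> rip (- f) g = - rip f g.
Proof.
move=> lf lg; rewrite -scalN1 (_ : -1 = ((-1)%:C)%C) ?rip_real ?mulN1r//.
by rewrite rmorphN1.
Qed.

Lemma ripBl f g h : l2 f -> l2 g -> l2 h -> rip (f - g) h = rip f h - rip g h.
Proof. by move=> lf lg lh; rewrite ripDl ?ripN//; exact: l2N. Qed.

Lemma ripDr f g h : l2 f -> l2 g -> l2 h -> rip h (f + g) = rip h f + rip h g.
Proof. by move=> lf lg lh; rewrite ripC ripDl// !(ripC h). Qed.

Lemma ripBr f g h : l2 f -> l2 g -> l2 h -> rip h (f - g) = rip h f - rip h g.
Proof. by move=> lf lg lh; rewrite ripC ripBl// !(ripC h). Qed.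

Lemma rip0l g : rip 0 g = 0.
Proof.
apply: (@rip_unique _ _ (fun=> 0)); last exact: cvg_cst.
by move=> A; rewrite psumE big1// => x _; rewrite /dot /= !mul0r addr0 mulr0.
Qed.

Lemma nsqD f g : l2 f -> l2 g -> nsq (f + g) = nsq f + 2 * rip f g + nsq g.
Proof.
move=> lf lg; have lfg := l2D lf lg.
by rewrite /nsq ripDl// !ripDr// (ripC g f); ring.
Qed.

Lemma nsqB f g : l2 f -> l2 g -> nsq (f - g) = nsq f - 2 * rip f g + nsq g.
Proof.
move=> lf lg; have lfg := l2B lf lg.
by rewrite /nsq ripBl// !ripBr// (ripC g f); ring.
Qed.

Lemma nsqZ c f : l2 f -> nsq (scal c f) = dot c c * nsq f.
Proof.
move=> lf; apply: rip_unique (cvgZl_tmp (k := dot c c) (rip_cvg lf lf)) => A.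
by rewrite nsq_scal_psum.
Qed.

Lemma nsqN f : l2 f -> nsq (- f) = nsq f.
Proof. by move=> lf; rewrite -scalN1 nsqZ// /dot /=; ring. Qed.

Lemma nsq0 : nsq 0 = 0.
Proof. exact: rip0l. Qed.

(** The second slot is conjugate-linear, so the imaginary part of [<f, g>] is the real part of
    [<f, i g>]. *)
Lemma l2_innerE f g : l2 f -> l2 g ->
  l2_inner w f g = (rip f g +i* rip f (scal 'i%C g))%C.
Proof.
move=> lf lg; apply: (@cvg_lim C^o); first exact: norm_hausdorff.
have cfg := cvg_complex (rip_cvg lf lg) (rip_cvg lf (l2Z 'i%C lg)).
suff -> : summability.partial_sum (fun x => (w x)%:C%C * f x * ((g x)^*)%C : C^o) =
  (fun A => Complex (psum (fun x => w x * dot (f x) (g x)) A)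
                    (psum (fun x => w x * dot (f x) (scal 'i%C g x)) A)) by exact: cfg.
apply: funext => A.
rewrite !psumE; elim: (enum_fset A) => [|x s IH]; first by rewrite !big_nil.
rewrite !big_cons [X in _ + X]IH /scal /dot /=.
case: (f x) (g x) => a b [a' b'] /=; congr (Complex _ _) => /=; ring.
Qed.

End L2Form.

(** * Bounded operators *)

Section Operators.
Context {R : realType} {X : choiceType} (w : X -> R).
Context (w_gt0 : forall x, 0 < w x).
Local Notation C := R[i].
Local Notation psum := (@summability.partial_sum X _).
Local Notation l2 := (l2 w).
Local Notation rip := (rip w).
Local Notation nsq := (nsq w).
Implicit Types (f g h : X -> C) (c z : C) (T W Z : (X -> C) -> (X -> C)).

(** The form of [bounded_operator] with real squared norms: stability of [l2], implicit in the
    extended bound, becomes a field, and the constant is positive so that it can be inverted. *)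
Record bop T : Prop := Bop {
  bop_linear : forall c f g, l2 f -> l2 g -> T (scal c f + g) = scal c (T f) + T g;
  bop_l2 : forall f, l2 f -> l2 (T f);
  bop_bound : exists2 M, 0 < M & forall f, l2 f -> nsq (T f) <= M * nsq f }.

Lemma bounded_operatorP T : bounded_operator w T <-> bop T.
Proof.
split=> [[lin [M bd]]|[lin st [M M0 bd]]].
  have st f : l2 f -> l2 (T f).
    move=> lf; have := bd f lf; rewrite (l2_sqnormE w_gt0 lf) -EFinM => h.
    by rewrite /Defs.l2 /=; apply: le_lt_trans h _; rewrite ltry.
  split=> //; exists (Num.max M 1) => [|f lf]; first by rewrite lt_max ltr01 orbT.
  have := bd f lf; rewrite (l2_sqnormE w_gt0 lf) (l2_sqnormE w_gt0 (st _ lf)) -EFinM lee_fin => h.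
  by apply: le_trans h _; rewrite ler_wpM2r ?nsq_ge0// le_max lexx.
split=> //; exists M => f lf.
by rewrite (l2_sqnormE w_gt0 lf) (l2_sqnormE w_gt0 (st _ lf)) -EFinM lee_fin bd.
Qed.

Lemma scal1 f : scal 1 f = f.
Proof. by apply: funext => x; rewrite /scal mul1r. Qed.

Lemma scalA c z f : scal c (scal z f) = scal (c * z) f.
Proof. by apply: funext => x; rewrite /scal mulrA. Qed.

Lemma scalDr c f g : scal c (f + g) = scal c f + scal c g.
Proof. by apply: funext => x; rewrite /scal [LHS]mulrDr. Qed.

Lemma scalBr c f g : scal c (f - g) = scal c f - scal c g.
Proof. by apply: funext => x; rewrite /scal [LHS]mulrBr. Qed.

Lemma bop0 T : bop T -> T 0 = 0.
Proof.
move=> bT; have l0 := l2_0 w_gt0; have := bop_linear bT 1 l0 l0.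
by rewrite !scal1 addr0 => /eqP; rewrite eq_sym -subr_eq0 addrK => /eqP.
Qed.

Lemma bopZ T c f : bop T -> l2 f -> T (scal c f) = scal c (T f).
Proof.
move=> bT lf; have := bop_linear bT c lf (l2_0 w_gt0).
by rewrite (bop0 bT) !addr0.
Qed.

Lemma bopD T f g : bop T -> l2 f -> l2 g -> T (f + g) = T f + T g.
Proof. by move=> bT lf lg; have := bop_linear bT 1 lf lg; rewrite !scal1. Qed.

Lemma bopB T f g : bop T -> l2 f -> l2 g -> T (f - g) = T f - T g.
Proof.
move=> bT lf lg; rewrite -scalN1 (bopD bT)//; last exact: l2Z.
by rewrite (bopZ _ bT)// scalN1.
Qed.

Lemma bop_comp T W : bop T -> bop W -> bop (T \o W).
Proof.
move=> [lT sT [M M0 bT]] [lW sW [M' M'0 bW]]; split=> [c f g lf lg|f lf|] /=.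
- by rewrite lW// lT//; exact: sW.
- exact/sT/sW.
- exists (M * M') => [|f lf]; first exact: mulr_gt0.
  by rewrite (le_trans (bT _ (sW _ lf)))// -mulrA ler_pM2l// bW.
Qed.

Lemma bop_scal c : bop (scal c).
Proof.
split=> [a f g lf lg|f lf|]; last 1 first.
- exists (dot c c + 1) => [|f lf]; first by rewrite ltr_wpDl ?dot_ge0.
  by rewrite nsqZ// ler_wpM2r ?nsq_ge0// lerDl.
- by rewrite scalDr !scalA mulrC.
- exact: l2Z.
Qed.

Lemma bop_sub T W : bop T -> bop W -> bop (fun f => T f - W f).
Proof.
move=> [lT sT [M M0 bT]] [lW sW [M' M'0 bW]]; split=> [c f g lf lg|f lf|] /=.
- by rewrite lW// lT// scalBr opprD addrACA.
- exact (l2B w_gt0 (sT _ lf) (sW _ lf)).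
- exists (2 * M + 2 * M') => [|f lf]; first by rewrite addr_gt0 ?mulr_gt0.
  have sTf := sT _ lf; have sWf := sW _ lf.
  have := nsq_ge0 w_gt0 (l2D w_gt0 sTf sWf); have hT := bT _ lf; have hW := bW _ lf.
  by rewrite (nsqB w_gt0)// (nsqD w_gt0)// => h; lra.
Qed.

Lemma eq_bop T W : bop T -> (forall f, l2 f -> W f = T f) -> bop W.
Proof.
move=> [lT sT [M M0 bT]] WT; split=> [c f g lf lg|f lf|].
- by rewrite !WT//; [exact: lT|apply: l2D => //; exact: l2Z].
- by rewrite WT//; exact: sT.
- by exists M => // f lf; rewrite WT// bT.
Qed.

(** Preimages are picked by choice. The lower bound makes [Z] injective, which forces the choice to
    be linear, and bounds the inverse by [k^-1] in squared norm. *)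
Lemma bop_inverse Z (k : R) : bop Z -> 0 < k ->
    (forall f, l2 f -> k * nsq f <= nsq (Z f)) ->
    (forall f, l2 f -> exists2 v, l2 v & Z v = f) ->
  exists2 Y, bop Y & forall f, l2 f -> Y (Z f) = f /\ Z (Y f) = f.
Proof.
move=> bZ k0 lowZ surZ.
have injZ f g : l2 f -> l2 g -> Z f = Z g -> f = g.
  move=> lf lg e; apply/eqP; rewrite -subr_eq0; apply/eqP.
  have lfg : l2 (f - g) by exact: l2B.
  apply: nsq_eq0 => //; rewrite -(pmulr_rle0 _ k0) (le_trans (lowZ _ lfg))//.
  by rewrite (bopB bZ)// e subrr nsq0.
have [Y YP] : exists Y, forall f, l2 f -> l2 (Y f) /\ Z (Y f) = f.
  have /choice[Y YP] : forall f, exists v, l2 f -> l2 v /\ Z v = f.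
    move=> f; have [/surZ[v lv <-]|nlf] := pselect (l2 f); first by exists v.
    by exists f.
  by exists Y.
exists Y; last first.
  move=> f lf; have [lY ZY] := YP f lf; split=> //.
  have [lYZ ZYZ] := YP _ (bop_l2 bZ lf); exact: injZ.
split=> [c f g lf lg|f lf|].
- have [lYf Zf] := YP f lf; have [lYg Zg] := YP g lg.
  have lcfg : l2 (scal c f + g) by apply: l2D => //; exact: l2Z.
  have [lYc Zc] := YP _ lcfg.
  apply: injZ => //; first by apply: l2D => //; exact: l2Z.
  by rewrite Zc (bop_linear bZ)// Zf Zg.
- by have [] := YP f lf.
- exists k^-1; rewrite ?invr_gt0// => f lf; have [lYf Zf] := YP f lf.
  by rewrite ler_pdivlMl// -{2}Zf lowZ.
Qed.

End Operators.

(** * Completeness and the Neumann iteration *)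

Section Completeness.
Context {R : realType} {X : choiceType} (w : X -> R).
Context (w_gt0 : forall x, 0 < w x).
Local Notation C := R[i].
Local Notation psum := (@summability.partial_sum X _).
Local Notation l2 := (l2 w).
Local Notation rip := (rip w).
Local Notation nsq := (nsq w).
Implicit Types (f g h : X -> C) (c z : C) (T W Z : (X -> C) -> (X -> C)).

(** Young's inequality: expand [|t f - g|^2 >= 0] and divide by [t]. The parameter allows a factor
    close to [1] on [f]. *)
Lemma nsqD_le (t : R) f g : 0 < t -> l2 f -> l2 g ->
  nsq (f + g) <= (1 + t) * nsq f + (1 + t^-1) * nsq g.
Proof.
move=> t0 lf lg.
have ltf : l2 (scal (t%:C)%C f) by exact (l2Z w_gt0 _ lf).
have := nsq_ge0 w_gt0 (l2B w_gt0 ltf lg).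
rewrite (nsqB w_gt0)// (nsqD w_gt0)// (nsqZ w_gt0)// (rip_real w_gt0)//.
rewrite (_ : dot _ _ = t ^+ 2); last by rewrite /dot /=; ring.
move=> h; have ti : t^-1 * t = 1 by rewrite mulVf// gt_eqF.
have : 0 <= t^-1 * (t ^+ 2 * nsq f - 2 * (t * rip f g) + nsq g).
  by rewrite mulr_ge0// invr_ge0 ltW.
rewrite [X in 0 <= X](_ : _ = (t^-1 * t) * t * nsq f - (t^-1 * t) * 2 * rip f g + t^-1 * nsq g).
  by rewrite ti => h'; lra.
by ring.
Qed.

Lemma geometric_small (K r e : R) : 0 <= r < 1 -> 0 < e ->
  exists n, K * r ^+ n < e.
Proof.
move=> /andP[r0 r1] e0.
have /cvgr_lt/(_ _ e0) : geometric K r @ \oo --> 0.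
  by apply: cvg_geometric; rewrite ger0_norm.
by case=> n _ /(_ n (leqnn n)) /= ?; exists n.
Qed.

Lemma geometric_le0 (x K r : R) : 0 <= r < 1 -> (forall n, x <= K * r ^+ n) -> x <= 0.
Proof.
move=> r01 xK; rewrite leNgt; apply/negP => x0.
by have [n] := geometric_small K r01 x0; rewrite ltNge xK.
Qed.

Lemma sq_geometric_cvg (a : R^nat) (K r : R) : 0 <= r < 1 ->
  (forall n k, (a (n + k)%N - a n) ^+ 2 <= K * r ^+ n) -> cvg (a @ \oo).
Proof.
move=> r01 aP; apply: cauchy_cvg; apply: cauchy_exP => e e0.
have [n Kn] := geometric_small K r01 (exprn_gt0 2 e0).
exists (a n); exists n => // m /= nm; rewrite /ball /=.
rewrite -ltr_sqr ?nnegrE ?(ltW e0)// real_normK ?num_real// (le_lt_trans _ Kn)//.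
by have := aP n (m - n)%N; rewrite subnKC// -sqrrN opprB.
Qed.

Lemma psum_cvgn (a : nat -> X -> R) (b : X -> R) A :
  (forall x, a ^~ x @ \oo --> b x) -> (fun n => psum (a n) A) @ \oo --> psum b A.
Proof.
move=> ab; rewrite psumE.
have -> : (fun n => psum (a n) A) = (fun n => \sum_(x <- A) a n x).
  by apply: funext => n; rewrite psumE.
elim: (enum_fset A) => [|x s IH].
  rewrite big_nil (_ : (fun n => _) = fun=> 0); first exact: cvg_cst.
  by apply: funext => n; rewrite big_nil.
rewrite big_cons (_ : (fun n => _) = (a ^~ x \+ fun n => \sum_(y <- s) a n y)).
  by apply: cvgD; [exact: ab | exact: IH].
by apply: funext => n; rewrite big_cons.
Qed.

(** The sequence is Cauchy at each point, and the error bound passes to the pointwise limit through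
    finite partial sums. The rate is kept because the Neumann iteration needs it. *)
Lemma l2_complete (u : nat -> X -> C) (K r : R) : 0 <= r < 1 -> (forall n, l2 (u n)) ->
    (forall n, nsq (u n.+1 - u n) <= K * r ^+ n) ->
  exists2 v, l2 v & exists L, forall n, nsq (v - u n) <= L * r ^+ n.
Proof.
move=> r01 lu du; have /andP[r0 r1] := r01.
have K0 : 0 <= K.
  have := le_trans (nsq_ge0 w_gt0 (l2B w_gt0 (lu 1%N) (lu 0%N))) (du 0%N).
  by rewrite expr0 mulr1.
(* (1 + t) r = (1 + r) / 2 < 1, whence the telescoping estimate below closes. *)
pose t := (1 - r) / (2 * r + 1).
have t0 : 0 < t by apply: divr_gt0; lra.
have tr : (1 + t) * r <= (1 + r) / 2.
  have : t * (2 * r + 1) = 1 - r by rewrite /t divfK// gt_eqF//; lra.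
  by nra.
(* [L] solves [L = (1 + r) / 2 * L + (1 + t^-1) * K], so the bound [L * r ^+ n] reproduces itself
   when [u n.+1] is inserted between [u n] and [u (n + k.+1)]. *)
pose L := (1 + t^-1) * K * (2 / (1 - r)).
have rN0 : 1 - r != 0 by rewrite gt_eqF// subr_gt0.
have LE : L * ((1 - r) / 2) = (1 + t^-1) * K.
  by rewrite -mulrA (_ : 2 / (1 - r) * _ = 1) ?mulr1//; field.
have ti0 : 0 < t^-1 by rewrite invr_gt0.
have L0 : 0 <= L by rewrite !mulr_ge0 ?invr_ge0//; lra.
have dk k : forall n, nsq (u (n + k)%N - u n) <= L * r ^+ n.
  elim: k => [|k IH] n; first by rewrite addn0 subrr nsq0// mulr_ge0 ?exprn_ge0.
  rewrite (_ : u (n + k.+1)%N - u n = (u (n.+1 + k)%N - u n.+1) + (u n.+1 - u n)); last first.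
    by rewrite addrA subrK addSnnS.
  have l1 : l2 (u (n.+1 + k)%N - u n.+1) by exact (l2B w_gt0 (lu _) (lu _)).
  have l2' : l2 (u n.+1 - u n) by exact (l2B w_gt0 (lu _) (lu _)).
  apply: le_trans (nsqD_le t0 l1 l2') _.
  have h1 : (1 + t) * nsq (u (n.+1 + k)%N - u n.+1) <= (1 + t) * (L * (r * r ^+ n)).
    by rewrite ler_pM2l ?IH -?exprS//; lra.
  have h2 : (1 + t^-1) * nsq (u n.+1 - u n) <= (1 + t^-1) * (K * r ^+ n).
    by rewrite ler_pM2l ?du//; lra.
  have h3 : (1 + t) * r * (L * r ^+ n) <= (1 + r) / 2 * (L * r ^+ n).
    by rewrite ler_wpM2r// mulr_ge0// exprn_ge0.
  rewrite mulrA -LE in h2.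
  by move: h1 h2 h3; set p := r ^+ n => h1 h2 h3; lra.
have ptk x n k : dot (u (n + k)%N x - u n x) (u (n + k)%N x - u n x) <= L / w x * r ^+ n.
  rewrite mulrAC ler_pdivlMr// mulrC.
  have lD : l2 (u (n + k)%N - u n) by exact (l2B w_gt0 (lu _) (lu _)).
  exact: le_trans (pt_le_nsq w_gt0 x lD) (dk k n).
have cRe x : cvg ((fun n => complex.Re (u n x)) @ \oo).
  apply: (@sq_geometric_cvg _ (L / w x) r) => // n k; apply: le_trans (ptk x n k).
  by case: (u _ x) (u n x) => a b [a' b']; rewrite /dot /= -!expr2 lerDl sqr_ge0.
have cIm x : cvg ((fun n => complex.Im (u n x)) @ \oo).
  apply: (@sq_geometric_cvg _ (L / w x) r) => // n k; apply: le_trans (ptk x n k).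
  by case: (u _ x) (u n x) => a b [a' b']; rewrite /dot /= -!expr2 lerDr sqr_ge0.
pose v x : C := Complex (lim ((fun n => complex.Re (u n x)) @ \oo))
                        (lim ((fun n => complex.Im (u n x)) @ \oo)).
(* Fatou's argument: each finite partial sum obeys the bound along the sequence, hence at the limit;
   [nsq_le] then yields membership in [l2] as well. *)
have vu n : l2 (v - u n) /\ nsq (v - u n) <= L * r ^+ n.
  apply: nsq_le => // A.
  have cA : (fun k => psum (fun x => w x * dot ((u k - u n) x) ((u k - u n) x)) A) @ \oo -->
      psum (fun x => w x * dot ((v - u n) x) ((v - u n) x)) A.
    apply: psum_cvgn => x; apply: cvgMl_tmp.
    rewrite (_ : dot _ _ =
        (complex.Re (v x) - complex.Re (u n x)) * (complex.Re (v x) - complex.Re (u n x)) +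
        (complex.Im (v x) - complex.Im (u n x)) * (complex.Im (v x) - complex.Im (u n x)));
      last first.
      by rewrite (_ : (v - u n) x = v x - u n x)//; case: (v x) (u n x) => a b [a' b'].
    rewrite (_ : (fun k => _) = (fun k =>
        (complex.Re (u k x) - complex.Re (u n x)) * (complex.Re (u k x) - complex.Re (u n x)) +
        (complex.Im (u k x) - complex.Im (u n x)) * (complex.Im (u k x) - complex.Im (u n x))));
      last first.
      apply: funext => k; rewrite (_ : (u k - u n) x = u k x - u n x)//.
      by case: (u k x) (u n x) => a b [a' b'].
    by apply: cvgD; apply: cvgM; apply: cvgB; (exact: cRe || exact: cIm || exact: cvg_cst).
  rewrite -(cvg_lim (@Rhausdorff R) cA); apply: limr_le; first exact: cvgP cA.
  exists n => // k /= nk.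
  have lD : l2 (u k - u n) by exact (l2B w_gt0 (lu _) (lu _)).
  by apply: le_trans (psum_le_nsq w_gt0 A lD) _; rewrite -(subnKC nk).
exists v; last by exists L => n; have [] := vu n.
rewrite -[v](subrK (u 0%N)); apply: l2D => //.
by have [] := vu 0%N.
Qed.

(** The iteration [v + (f - T v)] changes the residual [e = f - T v] into [e - T e], which
    contracts. The increments are these residuals, so [l2_complete] applies. *)
Lemma neumann_surjective T (r : R) : 0 <= r < 1 -> bop w T ->
    (forall f, l2 f -> nsq (f - T f) <= r * nsq f) ->
  forall f, l2 f -> exists2 v, l2 v & T v = f.
Proof.
move=> r01 bT conT f lf; have /andP[r0 r1] := r01.
pose u n := iter n (fun v => v + (f - T v)) 0.
have lu n : l2 (u n).
  elim: n => [|n IH]; first exact: l2_0.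
  apply: l2D => //; apply: l2B => //; exact: bop_l2 bT _ IH.
have le n : l2 (f - T (u n)) by apply: l2B => //; exact: bop_l2 bT _ (lu n).
have eE n : nsq (f - T (u n)) <= nsq f * r ^+ n.
  elim: n => [|n IH]; first by rewrite (bop0 w_gt0 bT) subr0 expr0 mulr1.
  rewrite /= (bopD bT)// opprD addrA exprS mulrCA.
  exact: le_trans (conT _ (le n)) (ler_wpM2l r0 IH).
have [|v lv [L vL]] := l2_complete (K := nsq f) r01 lu.
  by move=> n; rewrite /= addrAC subrr add0r.
exists v => //; apply/eqP; rewrite eq_sym -subr_eq0; apply/eqP.
have lfv : l2 (f - T v) by apply: l2B => //; exact: bop_l2 bT _ lv.
apply: nsq_eq0 => //.
have [M M0 TM] := bop_bound bT.
(* The residual of the limit is that of [u n] plus [- T (v - u n)], both of geometric size; the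
   factors [2] come from [nsqD_le] at [t = 1]. *)
apply: (@geometric_le0 _ (2 * nsq f + 2 * (M * L)) r) => // n.
have lvu : l2 (v - u n) by exact (l2B w_gt0 lv (lu n)).
have lTvu : l2 (- T (v - u n)) by apply: l2N => //; exact: bop_l2 bT _ lvu.
have -> : f - T v = (f - T (u n)) + - T (v - u n).
  by rewrite (bopB w_gt0 bT)// opprB addrA addrNK.
apply: le_trans (nsqD_le ltr01 (le n) lTvu) _.
have := TM _ lvu; have := ler_wpM2l (ltW M0) (vL n); have := eE n.
rewrite (nsqN w_gt0) ?invr1; last exact: bop_l2 bT _ lvu.
set p := r ^+ n => h1 h2 h3; lra.
Qed.

End Completeness.

(** * The spectrum of W* W *)

Section Spectrum.
Context {R : realType} {X : choiceType} (w : X -> R).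
Context (w_gt0 : forall x, 0 < w x).
Local Notation C := R[i].
Local Notation l2 := (l2 w).
Local Notation rip := (rip w).
Local Notation nsq := (nsq w).
Implicit Types (f g h : X -> C) (c z : C) (T W Z : (X -> C) -> (X -> C)).

(** Only real parts are compared: for a complex-linear [T'], replacing [g] by [i g] recovers the
    imaginary parts. *)
Definition adjoint_pair T T' : Prop :=
  forall f g, l2 f -> l2 g -> rip (T f) g = rip f (T' g).

(** [Z' Z / M] is close enough to the identity for the Neumann iteration, which solves
    [Z' Z v = Z' f]; the lower bound on [Z'] then cancels [Z']. *)
Lemma adjoint_pair_surjective Z Z' (k : R) : bop w Z -> bop w Z' ->
    adjoint_pair Z Z' -> 0 < k ->
    (forall f, l2 f -> k * nsq f <= nsq (Z f)) ->
    (forall f, l2 f -> k * nsq f <= nsq (Z' f)) ->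
  forall f, l2 f -> exists2 v, l2 v & Z v = f.
Proof.
move=> bZ bZ' adjZ k0 lowZ lowZ' f lf.
have sZ := bop_l2 bZ; have sZ' := bop_l2 bZ'.
have [M0 M00 boundZ'] := bop_bound bZ'.
(* Adding [k] gives [M >= k], so the ratio [1 - k / M] is nonnegative. *)
pose M := M0 + k; have M_gt0 : 0 < M by apply: addr_gt0.
have MN0 : M != 0 by rewrite gt_eqF.
pose c : C := ((M^-1)%:C)%C.
have bB : bop w (scal c \o (Z' \o Z)).
  by apply: bop_comp => //; [exact: bop_scal | exact: bop_comp].
have r01 : 0 <= 1 - k / M < 1.
  rewrite subr_ge0 ler_pdivrMr// mul1r lerDr ltW//=.
  by rewrite ltrBlDr ltrDl divr_gt0.
(* In the expanded square, [M^-2 |Z' Z g|^2 <= M^-1 |Z g|^2] absorbs half of the cross term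
   [- 2 M^-1 |Z g|^2]; the other half is at most [- (k / M) |g|^2]. *)
have conB g : l2 g -> nsq (g - (scal c \o (Z' \o Z)) g) <= (1 - k / M) * nsq g.
  move=> lg; have lZg := sZ _ lg; have lZZg := sZ' _ lZg.
  have lcZ : l2 (scal c (Z' (Z g))) by exact (l2Z w_gt0 _ lZZg).
  rewrite /= (nsqB w_gt0)// (nsqZ w_gt0)// ripC (rip_real w_gt0)// ripC -adjZ//.
  rewrite (_ : dot c c = M^-1 * M^-1); last by rewrite /dot /=; ring.
  rewrite (_ : rip (Z g) (Z g) = nsq (Z g))//.
  have Mi0 : 0 < M^-1 by rewrite invr_gt0.
  have h1 : nsq (Z' (Z g)) <= M * nsq (Z g).
    apply: le_trans (boundZ' _ lZg) _; rewrite ler_wpM2r ?nsq_ge0//.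
    by rewrite lerDl ltW.
  have h2 : M^-1 * (M^-1 * nsq (Z' (Z g))) <= M^-1 * nsq (Z g).
    by rewrite ler_pM2l// ler_pdivrMl.
  have h3 : M^-1 * (k * nsq g) <= M^-1 * nsq (Z g) by rewrite ler_pM2l// lowZ.
  by rewrite -mulrA; move: h2 h3; set m := M^-1; lra.
have lcf : l2 (scal c (Z' f)) by exact (l2Z w_gt0 _ (sZ' _ lf)).
have [v lv vE] := neumann_surjective w_gt0 r01 bB conB lcf.
exists v => //; apply/eqP; rewrite -subr_eq0; apply/eqP.
have lZv := sZ _ lv; have lvf : l2 (Z v - f) by exact: l2B.
apply: nsq_eq0 => //; rewrite -(pmulr_rle0 _ k0); apply: le_trans (lowZ' _ lvf) _.
have : scal ((M%:C)%C) (scal c (Z' (Z v))) = scal (M%:C)%C (scal c (Z' f)) by rewrite -vE.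
rewrite !scalA -rmorphM mulfV// rmorph1 !scal1 (bopB w_gt0 bZ')// => ->.
by rewrite subrr nsq0.
Qed.

Lemma resolventP T z : bop w T -> (resolvent_set w T z <->
  exists2 Y, bop w Y & forall f, l2 f -> Y (T f - scal z f) = f /\ T (Y f) - scal z (Y f) = f).
Proof. by move=> bT; split=> -[Y /(bounded_operatorP w_gt0) bY YP]; exists Y. Qed.

(* [rip h (scal c f)] with [c] a fourth root of unity stands for the real part
   of [<h, f>] up to a rotation. *)
Lemma nsq_lower (d : R) c f h : 0 < d -> dot c c = 1 -> l2 f -> l2 h ->
  d * nsq f <= rip h (scal c f) -> d ^+ 2 * nsq f <= nsq h.
Proof.
move=> d0 c1 lf lh low.
have lcf : l2 (scal c f) by exact (l2Z w_gt0 _ lf).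
have ldcf : l2 (scal (d%:C)%C (scal c f)) by exact (l2Z w_gt0 _ lcf).
have := nsq_ge0 w_gt0 (l2B w_gt0 lh ldcf).
rewrite (nsqB w_gt0)// !(nsqZ w_gt0)// c1 mul1r ripC (rip_real w_gt0)// ripC.
rewrite (_ : dot _ _ = d ^+ 2); last by rewrite /dot /=; ring.
have : d * (d * nsq f) <= d * rip h (scal c f) by rewrite ler_pM2l.
by rewrite mulrA -expr2 => h1 h2; lra.
Qed.

Section Factored.
Context T W W' (bW : bop w W) (bW' : bop w W') (adjW : adjoint_pair W W').
Context (TE : forall f, l2 f -> T f = W' (W f)).

Lemma bop_factored : bop w T.
Proof. by apply: eq_bop (bop_comp bW' bW) _. Qed.

Lemma rip_factored f g : l2 f -> l2 g -> rip (T f) g = rip (W f) (W g).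
Proof.
move=> lf lg; have lWf := bop_l2 bW lf; have lWg := bop_l2 bW lg.
by rewrite TE// ripC -adjW// ripC.
Qed.

Lemma adjoint_pair_shift z :
  adjoint_pair (fun f => T f - scal z f) (fun f => T f - scal (z^*)%C f).
Proof.
move=> f g lf lg.
have lTf := bop_l2 bop_factored lf; have lTg := bop_l2 bop_factored lg.
have lzf : l2 (scal z f) by exact (l2Z w_gt0 _ lf).
have lzg : l2 (scal (z^*)%C g) by exact (l2Z w_gt0 _ lg).
rewrite (ripBl w_gt0)// (ripBr w_gt0)// rip_scall rip_factored//.
by rewrite [rip f (T g)]ripC rip_factored// (ripC _ (W g)).
Qed.

Lemma rip_scal_self c f : l2 f -> rip f (scal c f) = complex.Re c * nsq f.
Proof.
move=> lf; rewrite -(rip_real w_gt0)// -/(nsq f) [RHS]ripC; apply: eq_rip => x.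
by rewrite /scal /dot; case: c (f x) => [a b] [a' b'] /=; ring.
Qed.

(** The form [<T f, f> = |W f|^2] lies between [0] and [b |f|^2]. Off the segment, [z] is in one of
    the half-planes [Im z < 0], [Im z > 0], [Re z < 0], [Re z > b]; in each, a suitable unit [c]
    makes the real part of the rotated form of [T - z] at least [d |f|^2], with [d] the distance
    from [z] to the edge of the half-plane. *)
Lemma shift_lower (b : R) z : 0 <= b -> ~ real_segment 0 b z ->
    (forall f, l2 f -> nsq (W f) <= b * nsq f) ->
  exists2 k, 0 < k & forall f, l2 f -> k * nsq f <= nsq (T f - scal z f).
Proof.
move=> b0 zN Wb.
have l2T f : l2 f -> l2 (T f) by exact: bop_l2 bop_factored f.
have l2z f : l2 f -> l2 (scal z f) by move=> lf; exact (l2Z w_gt0 z lf).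
have l2s f : l2 f -> l2 (T f - scal z f).
  by move=> lf; exact (l2B w_gt0 (l2T _ lf) (l2z _ lf)).
have l2W f : l2 f -> l2 (W f) by exact: bop_l2 bW f.
have ripE c f : l2 f -> rip (T f - scal z f) (scal c f) =
    complex.Re c * nsq (W f) - complex.Re ((z^*)%C * c) * nsq f.
  move=> lf; have lcf : l2 (scal c f) by exact (l2Z w_gt0 c lf).
  have lTf := l2T _ lf; have lzf := l2z _ lf; have lWf := l2W _ lf.
  rewrite (ripBl w_gt0)// rip_factored// (bopZ w_gt0 _ bW)//.
  by rewrite rip_scall scalA !rip_scal_self.
have lowE c (d : R) : 0 < d -> dot c c = 1 ->
    (forall f, l2 f -> d * nsq f <= complex.Re c * nsq (W f) - complex.Re ((z^*)%C * c) * nsq f) ->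
    exists2 k, 0 < k & forall f, l2 f -> k * nsq f <= nsq (T f - scal z f).
  move=> d0 c1 low; exists (d ^+ 2); first exact: exprn_gt0.
  move=> f lf; apply: (nsq_lower d0 c1 lf (l2s _ lf)).
  by rewrite ripE// low.
case: z zN {l2z l2s ripE} lowE => x y zN lowE.
have [y0|y0|y0] := ltgtP y 0.
- apply: (lowE (0 +i* 1)%C (- y)); [by rewrite oppr_gt0| by rewrite /dot /=; ring|].
  by move=> f lf /=; lra.
- apply: (lowE (0 -i* 1)%C y); [by []| by rewrite /dot /=; ring|].
  by move=> f lf /=; lra.
have [x0|x0] := ltP x 0.
  apply: (lowE 1%C (- x)); [by rewrite oppr_gt0| by rewrite /dot /=; ring|].
  by move=> f lf /=; have := nsq_ge0 w_gt0 (l2W _ lf); lra.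
have [xb|xb] := leP x b.
  by exfalso; apply: zN; exists x => /=; rewrite ?in_itv/= ?x0 ?xb// y0.
apply: (lowE (-1)%C (x - b)); [by rewrite subr_gt0| by rewrite /dot /=; ring|].
by move=> f lf /=; have := Wb _ lf; lra.
Qed.

(** The adjoint of [T - z] is the shift by the conjugate of [z], also bounded below because the
    segment is invariant under conjugation. The two lower bounds give surjectivity, then a bounded
    inverse. *)
Lemma spectrum_subset (b : R) : 0 <= b ->
    (forall f, l2 f -> nsq (W f) <= b * nsq f) ->
  spectrum w T `<=` real_segment 0 b.
Proof.
move=> b0 Wb z; apply: contra_notP => zN; apply/(resolventP _ bop_factored).
have zN' : ~ real_segment 0 b (z^*)%C.
  by move=> [t tb tz]; apply: zN; exists t => //; rewrite -[z]conjcK -tz /= oppr0.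
have [k k0 low] := shift_lower b0 zN Wb.
have [k' k'0 low'] := shift_lower b0 zN' Wb.
have bsh c : bop w (fun f => T f - scal c f).
  by apply: bop_sub => //; [exact: bop_factored | exact: bop_scal].
pose m := Num.min k k'; have m0 : 0 < m by rewrite lt_min k0.
have [] := bop_inverse w_gt0 (bsh z) k0 low; last by move=> Y; exists Y.
apply: (adjoint_pair_surjective (bsh z) (bsh (z^*)%C) (adjoint_pair_shift z) m0) => f lf.
- by apply: le_trans (low _ lf); rewrite ler_wpM2r ?nsq_ge0// ge_min lexx.
- by apply: le_trans (low' _ lf); rewrite ler_wpM2r ?nsq_ge0// ge_min lexx orbT.
Qed.

(** The least admissible constant [m] is a spectral value, hence at most [b]: a resolvent at [m]
    would allow a smaller constant. The vector [f0] ensures that admissible constants are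
    nonnegative, so that the infimum exists. *)
Lemma bound_of_spectrum (b : R) : (exists2 f0, l2 f0 & 0 < nsq f0) ->
    spectrum w T `<=` real_segment 0 b ->
  forall f, l2 f -> nsq (W f) <= b * nsq f.
Proof.
move=> [f0 lf0 f0_gt0] Tb.
have lW f : l2 f -> l2 (W f) by exact: bop_l2 bW f.
pose S : set R := [set M | forall f, l2 f -> nsq (W f) <= M * nsq f].
have S_lb : lbound S 0.
  move=> M SM; rewrite -(pmulr_lge0 _ f0_gt0).
  exact: le_trans (nsq_ge0 w_gt0 (lW _ lf0)) (SM _ lf0).
have S_inf : has_inf S.
  by split; [have [M _ WM] := bop_bound bW; exists M | exists 0].
pose m := inf S.
have Sm : S m.
  (* If [f] has norm zero, any admissible constant gives the claim; otherwise the condition is a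
     lower bound on [M] and passes to the infimum. *)
  move=> f lf; have := nsq_ge0 w_gt0 lf; rewrite le_eqVlt => /orP[/eqP f0E|fgt0].
    have [M _ WM] := bop_bound bW.
    by rewrite -f0E mulr0; have := WM _ lf; rewrite -f0E mulr0.
  rewrite -ler_pdivrMr//; apply: lb_le_inf; first by case: S_inf.
  by move=> M SM; rewrite ler_pdivrMr// SM.
have m_ge0 : 0 <= m by apply: lb_le_inf => //; case: S_inf.
suff mb : m <= b.
  move=> f lf; apply: le_trans (Sm _ lf) _; rewrite ler_wpM2r ?nsq_ge0//.
suff : spectrum w T (m%:C)%C by move=> /Tb[t]; rewrite /= in_itv/= => /andP[_ tb] [<-].
move=> /(resolventP _ bop_factored)[Y bY YP].
have [K K0 YK] := bop_bound bY.
pose M := m + 1; have M0 : 0 < M by rewrite ltr_wpDl.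
(* A better bound than the infimum: with A = T - m one has
   |A f|^2 <= M a(f) for the nonnegative form a(f) = m |f|^2 - |W f|^2, while
   |f|^2 <= K |A f|^2. *)
suff : S (m - (K * M)^-1).
  move=> /(inf_lbound _); move=> /(_ (ex_intro _ 0 S_lb)).
  by rewrite leNgt ltrBlDr ltrDl invr_gt0 mulr_gt0.
move=> f lf.
have lTf := bop_l2 bop_factored lf.
have lmf : l2 (scal (m%:C)%C f) by exact (l2Z w_gt0 _ lf).
pose h := T f - scal (m%:C)%C f.
have lh : l2 h by exact (l2B w_gt0 lTf lmf).
have fh : nsq f <= K * nsq h by have [fE _] := YP _ lf; rewrite -{1}fE; apply: YK.
pose s := M^-1.
have lsh : l2 (scal (s%:C)%C h) by exact (l2Z w_gt0 _ lh).
have lWf := lW _ lf; have lWh := lW _ lh.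
have lsWh : l2 (scal (s%:C)%C (W h)) by exact (l2Z w_gt0 _ lWh).
(* Admissibility of [m] at [f + s h] gives [a(f) >= 2 s |h|^2 - s^2 m |h|^2 >= s |h|^2], as
   [s m <= 1]; with [|f|^2 <= K |h|^2] this improves [m] by the inverse of [K * M]. *)
have := Sm _ (l2D w_gt0 lf lsh).
rewrite (bopD bW)// (bopZ w_gt0 _ bW)// !(nsqD w_gt0)// !(nsqZ w_gt0)//.
rewrite (_ : dot _ _ = s ^+ 2); last by rewrite /dot /=; ring.
rewrite (ripC _ f) (ripC _ (W f)) !(rip_real w_gt0)// (ripC _ h) (ripC _ (W h)).
have hE : rip (W f) (W h) - m * rip f h = nsq h.
  by rewrite -rip_factored// -(rip_real w_gt0)// -(ripBl w_gt0).
have h2 : s ^+ 2 * (m * nsq h) <= s * nsq h.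
  have h_ge0 := nsq_ge0 w_gt0 lh.
  rewrite expr2 mulrA ler_wpM2r// -mulrA ger_pMr ?invr_gt0//.
  by rewrite /s ler_pdivrMl// mulr1 lerDl.
have h3 : 0 <= s ^+ 2 * nsq (W h) by rewrite mulr_ge0 ?sqr_ge0 ?nsq_ge0.
have h4 : (K * M)^-1 * nsq f <= s * nsq h.
  by rewrite invfM mulrAC [leRHS]mulrC ler_pM2r ?invr_gt0// ler_pdivrMl.
move=> h5; move: hE h2 h3 h4 h5; rewrite mulrBl.
set p := rip f h; set q := rip (W f) (W h).
move=> hE h2 h3 h4 h5.
have : s * (q - m * p) = s * nsq h by rewrite hE.
by lra.
Qed.

End Factored.
End Spectrum.

(** * Adjoints and test vectors *)

Section Adjoint.
Context {R : realType} {X : choiceType} (w : X -> R).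
Context (w_gt0 : forall x, 0 < w x).
Local Notation C := R[i].
Local Notation l2 := (l2 w).
Local Notation rip := (rip w).
Local Notation nsq := (nsq w).
Implicit Types (f g h : X -> C) (c z : C) (T W Z : (X -> C) -> (X -> C)).

Lemma bop_id : bop w idfun.
Proof. by apply: eq_bop (bop_scal w_gt0 1) _ => // f _; rewrite scal1. Qed.

Lemma adjoint_pair_comp T T' W W' : bop w W -> bop w T' ->
  adjoint_pair w T T' -> adjoint_pair w W W' ->
  adjoint_pair w (T \o W) (W' \o T').
Proof.
move=> bW bT' adjT adjW f g lf lg.
by rewrite /= adjT ?adjW//; [exact: bop_l2 bT' _ lg | exact: bop_l2 bW _ lf].
Qed.

Lemma is_adjointP T T' : bop w T ->
  (is_adjoint w T T' <-> bop w T' /\ adjoint_pair w T T').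
Proof.
move=> bT; rewrite /is_adjoint (bounded_operatorP w_gt0); split=> -[bT' adjT];
  split=> // f g lf lg; have lTf := bop_l2 bT lf; have lTg := bop_l2 bT' lg.
  by have := adjT f g lf lg; rewrite !(l2_innerE w_gt0)// => -[].
rewrite !(l2_innerE w_gt0)// adjT// -(bopZ w_gt0 _ bT')// adjT//.
exact (l2Z w_gt0 _ lg).
Qed.

(** [adjoint] is obtained by choice, but two adjoints agree on [l2]: pairing with the difference of
    their values at [g] shows that this difference has norm zero. *)
Lemma adjointE T T' : bop w T -> bop w T' -> adjoint_pair w T T' ->
  forall g, l2 g -> adjoint w T g = T' g.
Proof.
move=> bT bT' adjT g lg; rewrite /adjoint; case: pselect => [ex|[]]; last first.
  by exists T'; apply/is_adjointP.
case: cid => /= T'' /(is_adjointP _ bT)[bT'' adjT''].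
have lT' := bop_l2 bT' lg; have lT'' := bop_l2 bT'' lg.
have lB : l2 (T'' g - T' g) by exact: l2B.
apply/eqP; rewrite -subr_eq0; apply/eqP; apply: nsq_eq0 => //.
rewrite (_ : nsq _ = rip (T'' g - T' g) (T'' g - T' g))// (ripBr w_gt0)//.
by rewrite -adjT// -adjT''// subrr.
Qed.

(** Turns norm identities into identities between inner products; in particular, linear isometries
    preserve [rip]. *)
Lemma polarization f g : l2 f -> l2 g -> rip f g = (nsq (f + g) - nsq (f - g)) / 4.
Proof. by move=> lf lg; rewrite (nsqD w_gt0)// (nsqB w_gt0)//; field. Qed.

Lemma delta_l2 (x0 : X) : exists2 f, l2 f & 0 < nsq f.
Proof.
pose f x : C := if x == x0 then 1 else 0.
have lf : l2 f.
  apply/(l2_dotP w); rewrite (eq_esum (b := fun x => if x \in [set x0] then (w x)%:E else 0%E)).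
    by rewrite -esum_mkcond esum_set1 ?ltry// lee_fin ltW.
  move=> x _; rewrite /f; case: eqP => [->|xx0].
    by rewrite mem_set//= /dot /= !mul1r mul0r addr0 mulr1.
  by rewrite memNset//= /dot /= mul0r addr0 mulr0.
exists f => //; rewrite ltNge; apply/negP => /(nsq_eq0 w_gt0 lf).
by move=> /(congr1 (fun h => h x0)); rewrite /f eqxx => /eqP; rewrite oner_eq0.
Qed.

End Adjoint.

(** * Walks on graphs *)

Section GraphOperators.
Context {R : realType} {V : choiceType} (adj : rel V).
Context (adj_sym : symmetric adj) (adj_locfin : locally_finite adj).
Context (deg_ge3 : forall x, (3 <= degree adj x)%N).
Local Notation C := R[i].
Local Notation E := (oriented_edge adj).
Local Notation deg := (degree adj).
Local Notation wV := (@vertex_measure V adj R).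
Local Notation wE := (@edge_measure V adj R).
Implicit Types (x y : V) (e : E) (f g : E -> C) (phi psi : V -> C).

Lemma wV_gt0 x : 0 < wV x.
Proof. by rewrite /vertex_measure ltr0n (leq_trans _ (deg_ge3 x)). Qed.

Lemma wE_gt0 e : 0 < wE e.
Proof. exact: ltr01. Qed.

(** * Reversal of edges and stars of vertices *)

Lemma rev_subproof e : adj (val e).2 (val e).1.
Proof. by rewrite adj_sym (valP e). Qed.

Definition rev e : E := exist _ ((val e).2, (val e).1) (rev_subproof e).

Lemma revK : involutive rev.
Proof. by case=> -[x y] xy; apply: val_inj. Qed.

Lemma oriented_edge_inj e e' :
  origin e = origin e' -> terminus e = terminus e' -> e = e'.
Proof.
case: e e' => [[a b] ab] [[a' b'] ab']; rewrite /origin /terminus /= => aa' bb'.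
by apply: val_inj; rewrite /= aa' bb'.
Qed.

Definition out x : set E := [set e | origin e = x].

Lemma terminus_bij x : set_bij (out x) (neighbors adj x) (@terminus V adj).
Proof.
split.
- by case=> -[a b] ab /= ax; rewrite -ax.
- by move=> e e'; rewrite !inE => ex e'x; apply: oriented_edge_inj; rewrite ex e'x.
- by move=> y xy; exists (exist _ (x, y) xy).
Qed.

Lemma out_finite x : finite_set (out x).
Proof.
have [sub inj sur] := terminus_bij x.
rewrite -(eq_finite_set (inj_card_eq inj)).
by apply: sub_finite_set (adj_locfin x) => _ [e ex <-]; exact: sub.
Qed.

Lemma sum_out (K : nmodType) x (F : V -> K) :
  \sum_(e \in out x) F (terminus e) = \sum_(y \in neighbors adj x) F y.
Proof. by rewrite (reindex_fsbig _ _ _ _ (terminus_bij x)). Qed.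

Lemma sum_out_const (K : pzRingType) x (c : K) : \sum_(e \in out x) c = (deg x)%:R * c.
Proof.
rewrite (sum_out _ (fun=> c)) fsbig_finite//= big_const_seq count_predT iter_addr_0.
by rewrite /degree mulr_natl.
Qed.

(** The stars [out x] partition the edges and are finite, so norms of edge functions can be computed
    star by star. *)
Lemma esum_out (a : E -> \bar R) : (forall e, 0 <= a e)%E ->
  (\esum_(e in [set: E]) a e = \esum_(x in [set: V]) \sum_(e \in out x) a e)%E.
Proof.
move=> a0.
transitivity (\esum_(x in [set: V]) \esum_(e in out x) a e)%E; last first.
  by apply: eq_esum => x _; rewrite esum_fset//; exact: out_finite.
rewrite esum_esum//; apply: (@reindex_esum _ _ _ _ _ snd) => //; split=> //.
- move=> [x e] [x' e']; rewrite !inE /out /= => -[_ ex] [_ ex'] ee'.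
  by rewrite -ex -ex' ee'.
- by move=> e _; exists (origin e, e).
Qed.

Lemma deg_gt0 x : (0 : C) < (deg x)%:R.
Proof. by rewrite ltr0n (leq_trans _ (deg_ge3 x)). Qed.

Definition avg f x : C := (deg x)%:R^-1 * \sum_(e \in out x) f e.

Definition lift phi : E -> C := phi \o @origin V adj.

(** In the notation of the introduction, [proj] is [A], [flip] is [J], [damp] is multiplication by
    [q] and [scatter] is [K]. *)
Definition proj f : E -> C := lift (avg f).

Definition flip f : E -> C := f \o rev.

Definition damp f : E -> C := fun e => ((deg (origin e))%:R - 1)^-1 * f e.

Definition scatter f : E -> C := proj f - damp (f - proj f).

Lemma flipK : involutive flip.
Proof. by move=> f; apply: funext => e; rewrite /flip /= revK. Qed.

Lemma avg_linear c f g : avg (scal c f + g) = fun x => c * avg f x + avg g x.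
Proof.
apply: funext => x; rewrite /avg mulrCA -mulrDr; congr (_ * _).
by rewrite mulr_fsumr -fsbig_split//; exact: out_finite.
Qed.

Lemma proj_linear c f g : proj (scal c f + g) = scal c (proj f) + proj g.
Proof. by rewrite /proj avg_linear. Qed.

Lemma avg_lift phi : avg (lift phi) = phi.
Proof.
apply: funext => x; rewrite /avg.
rewrite (eq_fsbigr (fun=> phi x)); last by move=> e; rewrite inE /lift => <-.
by rewrite sum_out_const mulKf// gt_eqF// deg_gt0.
Qed.

Lemma proj_lift phi : proj (lift phi) = lift phi.
Proof. by rewrite /proj avg_lift. Qed.

Lemma srw_op_avg phi : srw_op adj phi = avg (flip (lift phi)).
Proof.
apply: funext => x; rewrite /srw_op /avg; congr (_ * _).
by rewrite -sum_out; apply: eq_fsbigr.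
Qed.

Lemma proj_flip_lift phi : proj (flip (lift phi)) = lift (srw_op adj phi).
Proof. by rewrite srw_op_avg. Qed.

(** The bracket is the sum of [f] over the star minus the term at [e]: [scatter] averages over the
    other edges of the star. *)
Lemma scatterE f e : scatter f e =
  ((deg (origin e))%:R - 1)^-1 * ((deg (origin e))%:R * proj f e - f e).
Proof.
have d1 : ((deg (origin e))%:R - 1 : C) != 0.
  by rewrite subr_eq0 pnatr_eq1 gtn_eqF// (leq_trans _ (deg_ge3 _)).
rewrite /scatter /damp [LHS](_ : _ = proj f e - ((deg (origin e))%:R - 1)^-1 * (f e - proj f e))//.
by field.
Qed.

(** Reversal turns the edges arriving at the origin of [e] into the edges leaving it, and the ban on
    backtracking into being different from [e]. *)
Lemma nbrw_op_scatter f : nbrw_op f = scatter (flip f).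
Proof.
apply: funext => e; rewrite scatterE /nbrw_op; congr (_ * _).
have -> : (deg (origin e))%:R * proj (flip f) e = \sum_(e' \in out (origin e)) flip f e'.
  by rewrite /proj /lift /= /avg mulVKf// gt_eqF// deg_gt0.
rewrite [in RHS](fsbigD1 e)//=; last exact: out_finite.
rewrite [RHS]addrAC subrr add0r; apply: (@reindex_fsbig _ _ _ _ _ rev); split.
- move=> e' [/= oe' ne']; split; first by rewrite -oe'.
  by move=> [_ te]; apply: ne'; apply: oriented_edge_inj; rewrite ?oe' ?te.
- by move=> e1 e2 _ _ /(inv_inj revK).
- move=> e' [te' nr]; exists (rev e'); last exact: revK.
  split; first by rewrite -te'.
  by move=> re'; apply: nr; rewrite -re'.
Qed.

(** * Norms under flipping, lifting and averaging *)

Lemma wE_dot f e : wE e * dot (f e) (f e) = dot (f e) (f e).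
Proof. exact: mul1r. Qed.

Lemma sqnorm_flip f : l2_sqnorm wE (flip f) = l2_sqnorm wE f.
Proof.
rewrite !l2_sqnorm_dot [RHS](@reindex_esum _ _ _ setT setT rev)//.
by rewrite setTT_bijective; exists rev; exact: revK.
Qed.

Lemma sqnorm_lift phi : l2_sqnorm wE (lift phi) = l2_sqnorm wV phi.
Proof.
rewrite !l2_sqnorm_dot esum_out; last by move=> e; rewrite lee_fin wE_dot dot_ge0.
apply: eq_esum => x _; rewrite fsumEFin; last exact: out_finite.
congr (_%:E); rewrite (eq_fsbigr (fun=> dot (phi x) (phi x))) ?sum_out_const//.
by move=> e; rewrite inE wE_dot /lift => <-.
Qed.

(** Pythagoras on each star, where [f - proj f] sums to zero and so is orthogonal to constants.
    Stated with extended values for arbitrary [f], it also shows that [proj] preserves [l2]. *)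
Lemma sqnorm_proj f :
  l2_sqnorm wE f = (l2_sqnorm wE (proj f) + l2_sqnorm wE (f - proj f)%R)%E.
Proof.
have d0 (h : E -> C) e : (0 <= (wE e * dot (h e) (h e))%:E)%E.
  by rewrite lee_fin wE_dot dot_ge0.
rewrite !l2_sqnorm_dot !esum_out// -esumD; last 2 first.
  by move=> x _; rewrite fsume_ge0.
  by move=> x _; rewrite fsume_ge0.
apply: eq_esum => x _; have fin := out_finite x.
rewrite !fsumEFin// -EFinD; congr (_%:E); rewrite !fsbig_finite//= -big_split/=.
have xE e : e \in fset_set (out x) -> proj f e = avg f x.
  by rewrite in_fset_set// inE /proj /lift => <-.
set m := avg f x.
have sum0 : \sum_(e <- fset_set (out x)) (f e - m) = 0.
  rewrite sumrB -!fsbig_finite// sum_out_const /m /avg mulVKf ?subrr//.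
  by rewrite gt_eqF// deg_gt0.
have dot0 (s : seq E) : \sum_(e <- s) dot m (f e - m) = dot m (\sum_(e <- s) (f e - m)).
  elim: s => [|e s IH]; first by rewrite !big_nil /dot /= !mulr0 addr0.
  by rewrite !big_cons IH [RHS]dotC dotDl !(dotC _ m).
rewrite [LHS](_ : _ = \sum_(e <- fset_set (out x))
    (wE e * dot (proj f e) (proj f e) + wE e * dot ((f - proj f) e) ((f - proj f) e)) +
    2 * \sum_(e <- fset_set (out x)) dot m (f e - m)).
  by rewrite dot0 sum0 /dot /= !mulr0 addr0 mulr0 addr0.
rewrite mulr_sumr -big_split/=; apply: eq_big_seq => e /xE ex.
rewrite !wE_dot (_ : (f - proj f) e = f e - proj f e)// ex -/m.
by rewrite /m; case: (f e) (avg f x) => a b [a' b']; rewrite /dot /=; ring.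
Qed.

Local Notation lE := (l2 wE).
Local Notation lV := (l2 wV).
Local Notation nE := (nsq wE).
Local Notation nV := (nsq wV).
Local Notation P := (srw_op adj : (V -> C) -> (V -> C)).
Local Notation S := (@nbrw_op V adj R).

Lemma l2_flip f : lE f -> lE (flip f).
Proof. by rewrite /l2 /= sqnorm_flip. Qed.

Lemma nsq_flip f : lE f -> nE (flip f) = nE f.
Proof.
move=> lf; apply: EFin_inj; rewrite -!(l2_sqnormE wE_gt0) ?sqnorm_flip//.
exact: l2_flip.
Qed.

Lemma l2_lift phi : lE (lift phi) <-> lV phi.
Proof. by rewrite /l2 /= sqnorm_lift. Qed.

Lemma nsq_lift phi : lV phi -> nE (lift phi) = nV phi.
Proof.
move=> lphi; apply: EFin_inj.
rewrite -(l2_sqnormE wV_gt0)// -(l2_sqnormE wE_gt0) ?sqnorm_lift//.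
exact/l2_lift.
Qed.

Lemma l2_proj f : lE f -> lE (proj f).
Proof.
rewrite /l2 /= sqnorm_proj; apply: le_lt_trans.
by rewrite leeDl// l2_sqnorm_ge0//; exact: wE_gt0.
Qed.

Lemma nsq_proj f : lE f -> nE f = nE (proj f) + nE (f - proj f).
Proof.
move=> lf; have lp := l2_proj lf; have lq := l2B wE_gt0 lf lp.
apply: EFin_inj; rewrite EFinD -(l2_sqnormE wE_gt0 lf) sqnorm_proj.
by rewrite !(l2_sqnormE wE_gt0).
Qed.

(** Degree at least [3] enters quantitatively here, as [q <= 1 / 2]; this gives [damp] the factor
    [1 / 4] in squared norm. *)
Lemma inv_deg_pred x : [/\ (0 : R) < (deg x)%:R - 1, ((deg x)%:R - 1 : R)^-1 <= 2^-1
  & (((deg x)%:R - 1) : C)^-1 = (((deg x)%:R - 1 : R)^-1)%:C%C].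
Proof.
have d3 : (3 : R) <= (deg x)%:R by rewrite ler_nat deg_ge3.
split; [lra | rewrite lef_pV2 ?posrE//; lra |].
by rewrite fmorphV rmorphB rmorph1 rmorph_nat.
Qed.

Lemma damp_dot f e : dot (damp f e) (damp f e) <= 4^-1 * dot (f e) (f e).
Proof.
rewrite /damp dotM; have [d0 d2 ->] := inv_deg_pred (origin e).
apply: ler_wpM2r; first exact: dot_ge0.
rewrite /dot /= mulr0 addr0.
have : 0 < ((deg (origin e))%:R - 1 : R)^-1 by rewrite invr_gt0.
by move: d2; set t := _^-1; nra.
Qed.

Lemma nsq_damp f : lE f -> lE (damp f) /\ nE (damp f) <= 4^-1 * nE f.
Proof.
move=> lf; apply: (nsq_le wE_gt0) => A.
apply: le_trans (_ : _ <= 4^-1 * summability.partial_sum (fun e => wE e * dot (f e) (f e)) A) _.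
  rewrite -psumZ; apply: ler_psum => e; rewrite !wE_dot; exact: damp_dot.
by rewrite ler_pM2l ?invr_gt0// psum_le_nsq//; exact: wE_gt0.
Qed.

(** * Boundedness of the edge operators and the loss in [scatter] *)

Lemma bop_flip : bop wE flip.
Proof.
split=> [//|f|]; first exact: l2_flip.
by exists 1 => // f lf; rewrite mul1r nsq_flip.
Qed.

Lemma bop_proj : bop wE proj.
Proof.
split=> [c f g _ _|f|]; [exact: proj_linear | exact: l2_proj|].
exists 1 => // f lf; rewrite mul1r (nsq_proj lf) lerDl.
by apply: nsq_ge0 wE_gt0 _ _; exact (l2B wE_gt0 lf (l2_proj lf)).
Qed.

Lemma bop_damp : bop wE damp.
Proof.
split=> [c f g _ _|f /nsq_damp[]//|]; last first.
  by exists 4^-1; rewrite ?invr_gt0// => f /nsq_damp[].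
by apply: funext => e; rewrite /damp /scal [LHS]mulrDr mulrCA.
Qed.

Lemma bop_residual : bop wE (fun f => f - proj f).
Proof. exact (bop_sub wE_gt0 (bop_id wE_gt0) bop_proj). Qed.

Lemma bop_scatter : bop wE scatter.
Proof. exact (bop_sub wE_gt0 bop_proj (bop_comp bop_damp bop_residual)). Qed.

Lemma bop_nbrw : bop wE S.
Proof.
apply: (eq_bop wE_gt0 (bop_comp bop_scatter bop_flip)) => f _.
exact: nbrw_op_scatter.
Qed.

(** On a star of degree [d] and mean [m], the values [(d m - f e) / (d - 1)] sum to
    [(d^2 m - d m) / (d - 1) = d m]. *)
Lemma proj_scatter f : proj (scatter f) = proj f.
Proof.
rewrite /proj; congr lift; apply: funext => x; rewrite {1}/avg.
have d0 := deg_gt0 x.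
rewrite (eq_fsbigr (fun e => ((deg x)%:R - 1)^-1 * ((deg x)%:R * avg f x - f e))); last first.
  by move=> e; rewrite inE scatterE /proj /lift /= => ->.
rewrite -mulr_fsumr fsbig_finite//=; last exact: out_finite.
rewrite sumrB -!fsbig_finite/=; [|exact: out_finite..].
rewrite sum_out_const.
have -> : \sum_(e \in out x) f e = (deg x)%:R * avg f x.
  by rewrite /avg mulVKf// gt_eqF.
have d1 : ((deg x)%:R - 1 : C) != 0.
  by rewrite subr_eq0 pnatr_eq1 gtn_eqF// (leq_trans _ (deg_ge3 _)).
have dN0 : ((deg x)%:R : C) != 0 by rewrite gt_eqF.
by field; rewrite d1 dN0.
Qed.

Lemma scatter_residual f : scatter f - proj (scatter f) = - damp (f - proj f).
Proof. by rewrite proj_scatter /scatter addrAC subrr add0r. Qed.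

(** [scatter] keeps [proj f] and shrinks the residual at least by half, which removes at least three
    quarters of its squared norm. *)
Lemma nsq_scatter f : lE f -> nE (scatter f) <= nE f - 3 / 4 * nE (f - proj f).
Proof.
move=> lf; have lr := bop_l2 bop_residual lf; have [ld nd] := nsq_damp lr.
rewrite (nsq_proj (bop_l2 bop_scatter lf)) scatter_residual proj_scatter.
by rewrite (nsqN wE_gt0)// (nsq_proj lf); lra.
Qed.

Lemma scatter_lift phi : scatter (lift phi) = lift phi.
Proof.
rewrite /scatter proj_lift subrr (bop0 wE_gt0 bop_damp) subr0//.
Qed.

(** An isometric involution is self-adjoint; polarization carries the isometry over to inner
    products. *)
Lemma adjoint_flip : adjoint_pair wE flip flip.
Proof.
have iso f g : lE f -> lE g -> rip wE (flip f) (flip g) = rip wE f g.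
  move=> lf lg; rewrite !(polarization wE_gt0)//; [|exact: l2_flip..].
  have flipD : flip f + flip g = flip (f + g) by [].
  have flipB : flip f - flip g = flip (f - g) by [].
  rewrite flipD flipB !nsq_flip//; [exact (l2B wE_gt0 lf lg)|exact (l2D wE_gt0 lf lg)].
by move=> f g lf lg; rewrite -[g in LHS]flipK iso//; exact: l2_flip.
Qed.

(** Comparing Pythagoras for [f], [g] and [f + g] gives [pyth], by which [proj f] pairs with [g]
    only through [proj g]; symmetry follows. *)
Lemma adjoint_proj : adjoint_pair wE proj proj.
Proof.
have pl f := @bop_l2 _ _ _ _ bop_proj f; have rl f := @bop_l2 _ _ _ _ bop_residual f.
have pyth f g : lE f -> lE g ->
    rip wE f g = rip wE (proj f) (proj g) + rip wE (f - proj f) (g - proj g).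
  move=> lf lg; have lD := l2D wE_gt0 lf lg.
  have := nsq_proj lD; rewrite (bopD bop_proj)// opprD addrACA.
  have := nsq_proj lf; have := nsq_proj lg.
  have lpf := pl _ lf; have lpg := pl _ lg; have lrf := rl _ lf; have lrg := rl _ lg.
  by rewrite (nsqD wE_gt0 lf lg) (nsqD wE_gt0 lpf lpg) (nsqD wE_gt0 lrf lrg) => h1 h2 h3; lra.
have proj_proj f : proj (proj f) = proj f by exact: proj_lift.
have ort f g : lE f -> lE g -> rip wE (proj f) g = rip wE (proj f) (proj g).
  move=> lf lg; rewrite pyth//; last exact: pl.
  by rewrite proj_proj subrr rip0l addr0.
by move=> f g lf lg; rewrite ort// ripC -ort// ripC.
Qed.

Lemma adjoint_damp : adjoint_pair wE damp damp.
Proof.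
move=> f g _ _; apply: eq_rip => e; rewrite /damp.
by have [_ _ ->] := inv_deg_pred (origin e); rewrite dot_real dotC -dot_real dotC.
Qed.

(** The damping factor depends only on the origin, so it is constant on each star. *)
Lemma proj_damp f : proj (damp f) = damp (proj f).
Proof.
apply: funext => e; rewrite /proj /damp /lift /= /avg mulrCA; congr (_ * _).
by rewrite mulr_fsumr; apply: eq_fsbigr => e'; rewrite inE /out /= => ->.
Qed.

Lemma adjoint_scatter : adjoint_pair wE scatter scatter.
Proof.
move=> f g lf lg; have dl := @bop_l2 _ _ _ _ bop_damp.
have lpf := bop_l2 bop_proj lf; have lpg := bop_l2 bop_proj lg.
have lrf := bop_l2 bop_residual lf; have lrg := bop_l2 bop_residual lg.
have ldf := dl _ lrf; have ldg := dl _ lrg; have ldg' := dl _ lg.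
rewrite /scatter (ripBl wE_gt0)// (ripBr wE_gt0)// adjoint_proj//.
rewrite adjoint_damp// (ripBl wE_gt0)// adjoint_proj// proj_damp.
rewrite -(ripBr wE_gt0)//; last exact: dl.
by rewrite -(bopB wE_gt0 bop_damp).
Qed.

Definition nbrw_star f : E -> C := flip (scatter f).

Lemma bop_nbrw_star : bop wE nbrw_star.
Proof. exact (bop_comp bop_flip bop_scatter). Qed.

Lemma adjoint_pair_nbrw : adjoint_pair wE S nbrw_star.
Proof.
move=> f g lf lg; rewrite nbrw_op_scatter.
exact (adjoint_pair_comp bop_flip bop_scatter adjoint_scatter adjoint_flip lf lg).
Qed.

Lemma nbrw_adjE f : lE f -> nbrw_adj f = nbrw_star f.
Proof. by move=> lf; apply: (adjointE wE_gt0 bop_nbrw bop_nbrw_star adjoint_pair_nbrw). Qed.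

(** * The simple random walk and its comparison with the non-backtracking one *)

Lemma l2_srw phi : lV phi -> lV (P phi).
Proof.
move=> lphi; apply/l2_lift; rewrite -proj_flip_lift.
by apply: l2_proj; apply: l2_flip; apply/l2_lift.
Qed.

Lemma nsq_srw phi : lV phi -> nV (P phi) = nE (proj (flip (lift phi))).
Proof. by move=> /l2_srw lP; rewrite proj_flip_lift nsq_lift. Qed.

Lemma nsq_srw_le phi : lV phi -> nV (P phi) <= nV phi.
Proof.
move=> lphi; have /l2_lift lL := lphi.
have lfL := l2_flip lL.
rewrite nsq_srw// -(nsq_lift lphi) -(nsq_flip lL) (nsq_proj lfL) lerDl.
by apply: nsq_ge0 wE_gt0 _ _; exact (bop_l2 bop_residual lfL).
Qed.

Lemma bop_srw : bop wV P.
Proof.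
split=> [c phi psi _ _|phi|]; first 1 last.
- exact: l2_srw.
- by exists 1 => // phi lphi; rewrite mul1r nsq_srw_le.
by rewrite !srw_op_avg; exact (avg_linear c (flip (lift phi)) (flip (lift psi))).
Qed.

Lemma adjoint_srw : adjoint_pair wV P P.
Proof.
have rip_lift phi psi : lV phi -> lV psi -> rip wV phi psi = rip wE (lift phi) (lift psi).
  move=> lphi lpsi; have /l2_lift lL := lphi; have /l2_lift lM := lpsi.
  rewrite (polarization wV_gt0)// (polarization wE_gt0)//.
  rewrite -(nsq_lift (l2D wV_gt0 lphi lpsi)) -(nsq_lift (l2B wV_gt0 lphi lpsi)).
  by [].
move=> phi psi lphi lpsi; have /l2_lift lL := lphi; have /l2_lift lM := lpsi.
have lPphi := l2_srw lphi; have lPpsi := l2_srw lpsi.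
have lfL := l2_flip lL; have lfM := l2_flip lM.
rewrite !rip_lift// -!proj_flip_lift.
(* Both projections are moved onto lifted functions, which they fix; only the flip remains. *)
rewrite (adjoint_proj lfL lM) -(adjoint_proj lL lfM) !proj_lift.
exact: adjoint_flip.
Qed.

(** For the flip of [lift phi], the first step returns [lift phi], as the flips cancel and [scatter]
    fixes lifted functions. The second step yields a function whose projection is the lift of
    [P phi]. *)
Lemma nsq_srw_le_nbrw2 phi : lV phi ->
  exists2 f, lE f /\ nE f = nV phi & nV (P phi) <= nE (S (S f)).
Proof.
move=> lphi; have /l2_lift lL := lphi; have lfL := l2_flip lL.
exists (flip (lift phi)); first by rewrite nsq_flip// nsq_lift.
have lSS := bop_l2 bop_nbrw (bop_l2 bop_nbrw lfL).
rewrite (nsq_proj lSS) nsq_srw// !nbrw_op_scatter flipK proj_scatter scatter_lift.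
rewrite lerDl; apply: nsq_ge0 wE_gt0 _ _.
by have := bop_l2 bop_residual lSS; rewrite !nbrw_op_scatter flipK scatter_lift proj_scatter.
Qed.

Lemma nsq_nbrw2_le (beta : R) : 0 < beta <= 1 ->
  (forall phi, lV phi -> nV (P phi) <= (1 - beta) * nV phi) ->
  forall f, lE f -> nE (S (S f)) <= (1 - 3 / 8 * beta) * nE f.
Proof.
move=> /andP[b0 b1] Pb f lf; rewrite !nbrw_op_scatter.
set g := flip f; have lg : lE g by exact: l2_flip.
have gf : nE g = nE f by exact: nsq_flip.
set h := flip (scatter g).
have lKg := bop_l2 bop_scatter lg.
have lh : lE h by exact: l2_flip.
have K1 := nsq_scatter lg; have K2 := nsq_scatter lh.
rewrite [nE h]nsq_flip// in K2.
have lr := bop_l2 bop_residual lg; have lpg := l2_proj lg.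
have [ld nd] := nsq_damp lr.
have lphi : lV (avg g) by apply/l2_lift.
have split_g := nsq_proj lg; rewrite [nE (proj g)](nsq_lift lphi) in split_g.
(* The bound on [P] says that flipping the lifted function [proj g] sends at least a fraction [beta]
   of its squared norm into the residual. *)
have gap : beta * nV (avg g) <= nE (flip (proj g) - proj (flip (proj g))).
  have := nsq_proj (l2_flip lpg).
  rewrite (nsq_flip lpg) [nE (proj g)](nsq_lift lphi) -(nsq_srw lphi).
  by have := Pb _ lphi => h1 h2; lra.
have hE : h = flip (proj g) - flip (damp (g - proj g)) by [].
have lfd := l2_flip ld; have lfp := l2_flip lpg.
have lrh := bop_l2 bop_residual lh; have lrd := bop_l2 bop_residual lfd.
(* [h] differs from the flip of [proj g] by a flipped damped residual, so this residual survives in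
   [h] up to an error of squared norm at most a quarter of [|g - proj g|^2]. *)
have res : flip (proj g) - proj (flip (proj g)) =
    (h - proj h) + (flip (damp (g - proj g)) - proj (flip (damp (g - proj g)))).
  have -> : h - proj h = (flip (proj g) - proj (flip (proj g))) -
      (flip (damp (g - proj g)) - proj (flip (damp (g - proj g)))).
    exact (bopB wE_gt0 bop_residual lfp lfd).
  by rewrite subrK.
have := nsqD_le wE_gt0 ltr01 lrh lrd; rewrite -res invr1 => le2.
have led : nE (flip (damp (g - proj g)) - proj (flip (damp (g - proj g)))) <=
    4^-1 * nE (g - proj g).
  apply: le_trans _ nd; rewrite -(nsq_flip ld) (nsq_proj lfd) lerDr.
  by apply: nsq_ge0 wE_gt0 _ _; exact: l2_proj.
have r0 := nsq_ge0 wE_gt0 lr.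
have a0 := nsq_ge0 wV_gt0 lphi.
rewrite -gf split_g; rewrite split_g in K1.
set a := nV (avg g) in a0 gap split_g K1 *.
set b := nE (g - proj g) in r0 led split_g K1 *.
have ba : beta * b <= b by rewrite -[leRHS]mul1r ler_wpM2r.
(* With [r = |h - proj h|^2], [K1] and [K2] bound the left side by [a + b / 4 - 3 / 4 * r], while
   [gap], [le2] and [led] give [r >= beta * a / 2 - b / 4]. The total is
   [(1 - 3 / 8 * beta) * a + 7 / 16 * b], and [7 / 16 <= 1 - 3 / 8 * beta] since [beta <= 1]. *)
by lra.
Qed.

End GraphOperators.

(** The first term of the minimum is at most [beta / 4]: [Q >= 2] gives [Q ^- 4 <= 1 / 2], and the
    denominator is at least [2]. *)
Lemma gap_constant_le (R : realType) (D : nat) (beta : R) : (3 <= D)%N -> 0 < beta ->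
  gap_constant D beta <= 3 / 8 * beta.
Proof.
move=> D3 b0; rewrite /gap_constant ge_min; apply/orP; left.
have D3' : (3 : R) <= D%:R by rewrite ler_nat.
have Q2 : 2 <= (D%:R - 1 : R) by lra.
have Q1 : 1 <= (D%:R - 1 : R) by lra.
set q := (D%:R - 1) ^- 4.
have q0 : 0 < q by rewrite invr_gt0 exprn_gt0// (lt_le_trans ltr01).
have q1 : q <= 2^-1.
  rewrite lef_pV2 ?posrE ?exprn_gt0// ?(lt_le_trans ltr01)//.
  by apply: le_trans Q2 _; exact: ler_eXnr.
have qb : 0 <= q * beta by rewrite mulr_ge0// ltW.
have e1 : 1 <= (1 + q * beta / 6) ^+ 2 by rewrite exprn_ege1//; lra.
rewrite ler_pdivrMr; last by rewrite mulr_gt0// (lt_le_trans ltr01).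
have h1 : q * beta <= 2^-1 * beta by rewrite ler_wpM2r// ltW.
have h2 : 3 / 8 * beta * (2 * 1) <= 3 / 8 * beta * (2 * (1 + q * beta / 6) ^+ 2).
  by rewrite !ler_pM2l//; lra.
by apply: le_trans h1 (le_trans _ h2); lra.
Qed.

Theorem theorem1p3 (R : realType) (V : choiceType) (adj : rel V) (D : nat)
  (V_infinite : infinite_set [set: V])
  (adj_sym : symmetric adj)
  (adj_irr : irreflexive adj)
  (adj_locfin : locally_finite adj)
  (deg_bounds : forall x : V, (3 <= degree adj x <= D)%N) :
  (forall c : R,
     spectrum (@edge_measure V adj R) (@nbrw_adj2_nbrw2 V adj R)
       `<=` real_segment 0 (1 - c) ->
     spectrum (@vertex_measure V adj R) (@srw_sq V adj R)
       `<=` real_segment 0 (1 - D%:R ^- 2 * c)) /\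
  (forall beta : R, 0 < beta ->
     spectrum (@vertex_measure V adj R) (@srw_sq V adj R)
       `<=` real_segment 0 (1 - beta) ->
     spectrum (@edge_measure V adj R) (@nbrw_adj2_nbrw2 V adj R)
       `<=` real_segment 0 (1 - gap_constant D beta)).
Proof.
have deg3 x : (3 <= degree adj x)%N by have /andP[] := deg_bounds x.
have [x0 _] : [set: V] !=set0 by apply: infinite_setN0.
have D3 : (3 <= D)%N by have /andP[] := deg_bounds x0; exact: leq_trans.
have wV0 := @wV_gt0 R V adj deg3; have wE0 := @wE_gt0 R V adj.
have bS := bop_nbrw (R := R) adj_sym adj_locfin deg3.
have bS' := bop_nbrw_star (R := R) adj_sym adj_locfin deg3.
have adjS := adjoint_pair_nbrw (R := R) adj_sym adj_locfin deg3.
have bP := bop_srw (R := R) adj_sym adj_locfin deg3.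
have adjP := adjoint_srw (R := R) adj_sym adj_locfin deg3.
have bSS := bop_comp bS bS; have bSS' := bop_comp bS' bS'.
have adjSS := adjoint_pair_comp bS bS' adjS adjS.
(* The choice-made [nbrw_adj] is known only on [l2], so the factorization is established there. *)
have TE f : l2 (@edge_measure V adj R) f -> nbrw_adj2_nbrw2 f =
    (nbrw_star adj_sym \o nbrw_star adj_sym) ((@nbrw_op V adj R \o @nbrw_op V adj R) f).
  move=> lf; have lSS := bop_l2 bSS lf.
  rewrite /nbrw_adj2_nbrw2 /= (nbrw_adjE adj_sym adj_locfin deg3 lSS).
  by rewrite (nbrw_adjE adj_sym adj_locfin deg3 (bop_l2 bS' lSS)).
have [phi0 lphi0 phi0_gt0] := delta_l2 wV0 x0.
have [y0 xy0] : exists y, adj x0 y.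
  apply: contrapT => /forallNP noadj; have := deg3 x0; rewrite /degree.
  by rewrite (_ : neighbors adj x0 = set0) ?fset_set0//; apply/seteqP; split.
pose e0 : oriented_edge adj := exist _ (x0, y0) xy0.
have delta_e := delta_l2 wE0 e0.
split=> [c spec | beta b0 spec].
  have SSc := bound_of_spectrum wE0 bSS bSS' adjSS TE delta_e spec.
  have Pc phi : l2 (@vertex_measure V adj R) phi ->
      nsq (@vertex_measure V adj R) (srw_op adj phi) <=
      (1 - D%:R ^- 2 * c) * nsq (@vertex_measure V adj R) phi.
    move=> lphi; have n0 := nsq_ge0 wV0 lphi.
    have D2 : 0 < (D%:R ^- 2 : R) <= 1.
      rewrite invr_gt0 exprn_gt0 ?ltr0n ?(leq_trans _ D3)//=.
      by rewrite invf_le1 ?exprn_ege1 ?exprn_gt0 ?ler1n ?ltr0n ?(leq_trans _ D3).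
    have /andP[D2_gt0 D2_le1] := D2.
    (* For [c >= 0], the factor [D ^- 2 <= 1] only weakens the bound; for [c < 0], the constant
       exceeds [1] and contractivity of [P] suffices. *)
    have [c0|c0] := leP 0 c.
      have [f [lf nf] le] := nsq_srw_le_nbrw2 adj_sym adj_locfin deg3 lphi.
      apply: le_trans le _; apply: le_trans (SSc _ lf) _; rewrite nf.
      by rewrite ler_wpM2r// lerD2l lerN2 ler_piMl.
    apply: le_trans (nsq_srw_le adj_sym adj_locfin deg3 lphi) _.
    by rewrite ler_peMl// lerDl oppr_ge0 pmulr_rle0// ltW.
  (* As [P] is its own adjoint, [srw_sq] has the form [W* W] with [W = P], by conversion. The
     nonzero vector [phi0] then forces the right end of the segment to be nonnegative. *)
  apply: (spectrum_subset wV0 bP bP adjP (fun _ _ => erefl)) => //.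
  rewrite -(pmulr_lge0 _ phi0_gt0); apply: le_trans (Pc _ lphi0).
  exact (nsq_ge0 wV0 (bop_l2 bP lphi0)).
have Pb := bound_of_spectrum wV0 bP bP adjP (fun _ _ => erefl)
  (ex_intro2 _ _ phi0 lphi0 phi0_gt0) spec.
(* Again a nonzero vector excludes a negative constant; [nsq_nbrw2_le] needs this upper bound on
   [beta]. *)
have b1 : beta <= 1.
  rewrite -subr_ge0 -(pmulr_lge0 _ phi0_gt0); apply: le_trans (Pb _ lphi0).
  exact (nsq_ge0 wV0 (bop_l2 bP lphi0)).
have gap := gap_constant_le D3 b0.
apply: (spectrum_subset wE0 bSS bSS' adjSS TE); first by lra.
move=> f lf; have := nsq_nbrw2_le adj_sym adj_locfin deg3 (beta := beta) _ Pb lf.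
rewrite b0 b1 => /(_ isT) /le_trans; apply; rewrite ler_wpM2r ?lerD2l ?lerN2//.
exact (nsq_ge0 wE0 lf).
Qed.
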